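(* For three agents with monotone continuous valuations over the lips tangle $\mathcal{L}$, an envy-free allocation with connected shares always exists.
   Context: The lips tangle $\mathcal{L}$ is the topological space with three distinguished points $a,b,c$ and five arcs (copies of $[0,1]$ with endpoints identified to these points): two arcs joining $a$ and $b$, two arcs joining $b$ and $c$, and one arc joining $a$ and $c$, the arcs being otherwise disjoint. (So $a$ and $c$ have degree $3$ and $b$ has degree $4$.) A valuation on $\mathcal{L}$ assigns a nonnegative real number $\nu(X)$ to every connected subset $X\subseteq\mathcal{L}$. It is monotone continuous if (1) $\nu(\emptyset)=0$ and $\nu(X)\le\nu(Y)$ for connected $X\subseteq Y$; and (2) identifying each of the five open arcs (edges) $e_i$ homeomorphically with a copy $[0,1]_i$ of the unit interval, and letting, for $z=(x_1,y_1,\dots,x_5,y_5)$, $X(z)$ be the closed subset of $\mathcal{L}$ whose intersection with each $e_i$ corresponds to $[x_i,y_i]\cap[0,1]_i$, the function $z\mapsto\nu(X(z))$, restricted to those $z$ with $X(z)$ closed and connected, is continuous. An allocation with connected shares to agents $1,2,3$ is a triple $(T_1,T_2,T_3)$ of pairwise disjoint connected subsets of $\mathcal{L}$ with union $\mathcal{L}$; it is envy-free for valuations $\nu_1,\nu_2,\nu_3$ if $\nu_i(T_i)\ge\nu_i(T_j)$ for all $i,j$. *)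

(* Defs.v *)
From HB Require Import structures.
From mathcomp Require Import all_boot all_order all_algebra generic_quotient.
From mathcomp Require Import all_classical all_reals all_analysis.
Import Order.TTheory GRing.Theory Num.Theory.
Import numFieldNormedType.Exports.

Set Implicit Arguments.
Unset Strict Implicit.
Unset Printing Implicit Defensive.

Local Open Scope classical_set_scope.
Local Open Scope ring_scope.
Local Open Scope quotient_scope.

Inductive lips_vertex := VA | VB | VC.

(* Arc i runs from [arc_src i] (parameter 0) to [arc_tgt i] (parameter 1):
   arcs 0, 1 join a and b; arcs 2, 3 join b and c; arc 4 joins a and c. *)
Definition arc_src (i : 'I_5) : lips_vertex :=
  if val i \in [:: 0; 1; 4]%N then VA else VB.
Definition arc_tgt (i : 'I_5) : lips_vertex :=
  if val i \in [:: 0; 1]%N then VB else VC.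

Definition arcs (R : realType) : Type :=
  {i : 'I_5 & set_type (`[0, 1] : set R)}.

HB.instance Definition _ (R : realType) := Topological.on (arcs R).

Definition arc_vertex (R : realType) (p : arcs R) : option lips_vertex :=
  if set_val (tagged p) == 0 then Some (arc_src (tag p))
  else if set_val (tagged p) == 1 then Some (arc_tgt (tag p))
  else None.

Definition glued (R : realType) (p q : arcs R) : bool :=
  `[< p = q \/ (arc_vertex p <> None /\ arc_vertex p = arc_vertex q) >].

Lemma glued_equiv (R : realType) : equiv_class_of (@glued R).
Proof.
split=> [p|p q|q p r].
- by apply/asboolP; left.
- apply/asboolP/asboolP => -[->|[nN e]]; [by left| |by left|];
    by right; split; rewrite -?e.
- move=> /asboolP pq /asboolP qr; apply/asboolP.
  case: pq => [->//|[nN e]].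
  case: qr => [<-|[_ e']]; first by right.
  by right; split=> //; rewrite e.
Qed.

Definition glued_equiv_rel (R : realType) : equiv_rel (arcs R) :=
  EquivRelPack (glued_equiv R).

Definition lips (R : realType) : Type :=
  quotient_topology {eq_quot (glued_equiv_rel R)}.

HB.instance Definition _ (R : realType) := Topological.on (lips R).

(* Row i of z holds the pair (x_i, y_i) of arbitrary reals; if x_i > y_i, or if
   [x_i, y_i] misses [0, 1], then row i contributes no point. *)
Definition interval_region (R : realType) (z : 'M[R]_(5, 2)) : set (lips R) :=
  (\pi_(lips R) : arcs R -> lips R) @`
    [set p | z (tag p) 0 <= set_val (tagged p) <= z (tag p) 1].

(* Only the values of nu at connected sets are meaningful. *)
Definition valuation (R : realType) (nu : set (lips R) -> R) : Prop :=
  forall X, connected X -> 0 <= nu X.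

Definition monotone_continuous (R : realType) (nu : set (lips R) -> R) : Prop :=
  [/\ nu set0 = 0,
      forall X Y, connected X -> connected Y -> X `<=` Y -> nu X <= nu Y
    & {within [set z | closed (interval_region z) /\
                       connected (interval_region z)],
        continuous (fun z : 'M[R]_(5, 2) => nu (interval_region z))}].

Definition connected_allocation (R : realType) (T : 'I_3 -> set (lips R)) : Prop :=
  [/\ forall i, connected (T i), trivIset setT T & \bigcup_i T i = setT].

Definition envy_free (R : realType) (nu : 'I_3 -> set (lips R) -> R)
    (T : 'I_3 -> set (lips R)) : Prop :=
  forall i j, nu i (T j) <= nu i (T i).

(* Main.v *)
Require Import Defs.
From HB Require Import structures.
From mathcomp Require Import all_boot all_order all_algebra.
From mathcomp Require Import all_classical all_reals all_analysis.
From mathcomp Require Import generic_quotient lra.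
Import Order.TTheory GRing.Theory Num.Theory.
Import numFieldNormedType.Exports.

(* Stromquist's moving knife.  Share 0 grows from a share of value 0 until shares
   1 and 2 have value 0, while a second cut keeps the median over the agents of
   (value of share 1) - (value of share 2) equal to 0, so that any two agents
   can divide shares 1 and 2 without envy.  At a moment when the best advantage
   of share 0 over the other two is 0, some agent can take share 0 and the
   allocation is envy-free.

   To keep all shares connected, compare the two arcs joining b and c with the
   rest K of the tangle.  If these arcs beat K in the median, cut the tangle as
   an interval along the trail c - a = b - c - b, where both arcs joining a and b
   are run through simultaneously and share 0 starts at c: the second cut stays
   outside K, so that no share lies strictly inside the doubled arcs.  The case
   of the arcs joining a and b is symmetric.  Otherwise share 0 starts at b and
   grows into both pairs of arcs, while the second cut stays on the arc a c.

   Shares need not be closed: each one is an increasing union of closed regions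
   that converge to its closed counterpart, hence has the same value. *)

Set Implicit Arguments.
Unset Strict Implicit.
Unset Printing Implicit Defensive.

Local Open Scope classical_set_scope.
Local Open Scope ring_scope.
Local Open Scope quotient_scope.

(** * Topological preliminaries *)

Lemma closed_preimage (T U : topologicalType) (f : T -> U) (A : set U) :
  continuous f -> closed A -> closed (f @^-1` A).
Proof. by move=> /continuous_closedP; apply. Qed.

Section ContinuityRules.
Variables (T : topologicalType) (R : realType).
Implicit Types f g : T -> R.

Lemma cont_pair (U V : topologicalType) (f : T -> U) (g : T -> V) :
  continuous f -> continuous g -> continuous (fun x => (f x, g x)).
Proof. by move=> fc gc x; exact: (cvg_pair (fc x) (gc x)). Qed.

Lemma cont_id : continuous (fun x : T => x).
Proof. by move=> x; exact: cvg_id. Qed.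

Lemma cont_const (U : topologicalType) (c : U) : continuous (fun _ : T => c).
Proof. by move=> x; exact: cvg_cst. Qed.

Lemma cont_fst (U V : topologicalType) (f : T -> U * V) :
  continuous f -> continuous (fun x => (f x).1).
Proof. by move=> fc x; exact: (continuous_comp (fc x) (@cvg_fst _ _ _ _ _)). Qed.

Lemma cont_snd (U V : topologicalType) (f : T -> U * V) :
  continuous f -> continuous (fun x => (f x).2).
Proof. by move=> fc x; exact: (continuous_comp (fc x) (@cvg_snd _ _ _ _ _)). Qed.

Lemma cont_add f g : continuous f -> continuous g -> continuous (fun x => f x + g x).
Proof. by move=> fc gc x; exact: (cvgD (fc x) (gc x)). Qed.

Lemma cont_opp f : continuous f -> continuous (fun x => - f x).
Proof. by move=> fc x; exact: (cvgN (fc x)). Qed.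

Lemma cont_max f g :
  continuous f -> continuous g -> continuous (fun x => Num.max (f x) (g x)).
Proof. by move=> fc gc x; exact: (continuous_max (fc x) (gc x)). Qed.

Lemma cont_min f g :
  continuous f -> continuous g -> continuous (fun x => Num.min (f x) (g x)).
Proof. by move=> fc gc x; exact: (continuous_min (fc x) (gc x)). Qed.

End ContinuityRules.

Ltac continuity :=
  intros;
  lazymatch goal with
  | |- continuous_at ?p (fun _ => ?c) => exact (@cont_const _ _ c p)
  | |- continuous_at ?p (fun x => x) => exact (@cont_id _ p)
  | |- continuous_at ?p (fun x => @?f x + @?g x) => refine (@cont_add _ _ f g _ _ p); continuity
  | |- continuous_at ?p (fun x => - @?f x) => refine (@cont_opp _ _ f _ p); continuity
  | |- continuous_at ?p (fun x => Order.max (@?f x) (@?g x)) =>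
      refine (@cont_max _ _ f g _ _ p); continuity
  | |- continuous_at ?p (fun x => Order.min (@?f x) (@?g x)) =>
      refine (@cont_min _ _ f g _ _ p); continuity
  | |- continuous_at ?p (fun x => (@?f x, @?g x)) => refine (@cont_pair _ _ _ f g _ _ p); continuity
  | |- continuous_at ?p (fun x => (@?f x).1) => refine (@cont_fst _ _ _ f _ p); continuity
  | |- continuous_at ?p (fun x => (@?f x).2) => refine (@cont_snd _ _ _ f _ p); continuity
  | |- _ => match goal with H : _ |- _ => solve [simple apply H] end
  end.

(** If [A] missed the intersection of [B] and [C], its trace on [B] would be closed in [A] and,
    being its trace on the complement of [C], also open in [A]. *)
Lemma connected_closed_cover (T : topologicalType) (A B C : set T) :
  connected A -> closed B -> closed C -> A `<=` B `|` C ->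
  A `&` B !=set0 -> A `&` C !=set0 -> A `&` (B `&` C) !=set0.
Proof.
move=> Aconn Bcl Ccl ABC AB0 [y [Ay Cy]]; apply: contrapT => /nonemptyPn ABC0.
have ABE : A `&` B = A.
  apply: Aconn => //; last by exists B.
  exists (~` C); first exact: closed_openC.
  apply/seteqP; split=> x [Ax Hx]; split=> //.
    by move=> Cx; rewrite -[False]/(set0 x) -ABC0.
  by have [] := ABC x Ax.
have [_ By] : (A `&` B) y by rewrite ABE.
by rewrite -[False]/(set0 y) -ABC0.
Qed.

Lemma IVT_continuous (R : realType) (f : R -> R) (a b : R) :
  continuous f -> a <= b -> f a <= 0 -> 0 <= f b ->
  exists2 c, a <= c <= b & f c = 0.
Proof.
move=> fcont ab fa fb.
have [|c] := @IVT _ f a b 0 ab (continuous_subspaceT fcont).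
  by rewrite ge_min le_max fa fb orbT.
by rewrite in_itv /= => ?; exists c.
Qed.

(** * The moving knife on a rectangle of cut positions *)

Section MovingKnife.
Variables (R : realType) (D h : R * R -> R) (a c d : R).
Hypotheses (Dcont : continuous D) (hcont : continuous h).
Hypotheses (a0 : 0 <= a) (cd : c <= d).
Hypothesis Dmono : forall t s s', 0 <= t <= a -> c <= s -> s <= s' -> s' <= d ->
  D (t, s) <= D (t, s').
Hypotheses (Dlo : forall t, 0 <= t <= a -> D (t, c) <= 0)
  (Dhi : forall t, 0 <= t <= a -> 0 <= D (t, d)).

Let pair_cont (t : R) : continuous (fun s : R => (t, s)).
Proof. continuity. Qed.

Let zeros (h' : R * R -> R) : set (R * R) :=
  (`[0, a] `*` `[c, d]) `&` ((D @^-1` [set x | x = 0]) `&` (h' @^-1` [set x | x <= 0])).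

Let times h' : set R := fst @` zeros h'.

(** The zero set is closed in a rectangle, hence compact, and so is its projection to the time
    axis. *)
Let times_closed h' : continuous h' -> closed (times h').
Proof.
move=> h'cont; apply: (compact_closed (@Rhausdorff R)); apply: continuous_compact.
  by apply: continuous_subspaceT; apply: (@cont_fst _ _ _ idfun); exact: cont_id.
apply: compact_closedI.
  by apply: compact_setX; exact: segment_compact.
by apply: closedI; [apply: closed_preimage (@closed_eq _ _)|apply: closed_preimage (@closed_le _ _)].
Qed.

(* If [h] had no zero on the zero set of [D], the times at which [h <= 0] and
   those at which [h >= 0] somewhere on that set would split [0, a]: a common
   time gives a segment of zeros of [D] (by monotonicity) along which [h]
   changes sign. *)
Lemma moving_knife :
  (exists2 s, c <= s <= d & D (0, s) = 0 /\ h (0, s) <= 0) ->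
  (forall s, c <= s <= d -> 0 <= h (a, s)) ->
  exists t s, [/\ 0 <= t <= a, c <= s <= d, D (t, s) = 0 & h (t, s) = 0].
Proof.
move=> [s0 s0cd [Ds0 hs0]] ha.
have zero_at t : 0 <= t <= a -> exists2 s, c <= s <= d & D (t, s) = 0.
  move=> ta; apply: IVT_continuous => //; [|exact: Dlo|exact: Dhi].
  by move=> s; apply: continuous_comp; [exact: pair_cont|exact: Dcont].
have hNcont : continuous (fun p => - h p).
  by move=> p; apply: cvgN; exact: hcont.
have mem h' t s : 0 <= t <= a -> c <= s <= d -> D (t, s) = 0 -> h' (t, s) <= 0 ->
    times h' t.
  by move=> ta scd Dts hts; exists (t, s).
have [t [ta [[[t1 s1] /= [[_ +] [D1 h1]] t11] [[t2 s2] /= [[_ +] [D2 h2]] t12]]]] :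
    `[0, a] `&` (times h `&` times (fun p => - h p)) !=set0.
  apply: connected_closed_cover => //.
  - exact: segment_connected.
  - exact: times_closed.
  - exact: times_closed.
  - move=> t /=; rewrite in_itv /= => ta; have [s scd Ds] := zero_at t ta.
    have [hts|hts] := leP (h (t, s)) 0; [left|right]; apply: (mem _ t s) => //.
    by rewrite oppr_le0 ltW.
  - exists 0; split; first by rewrite /= in_itv /= lexx.
    by apply: (mem _ 0 s0); rewrite ?lexx.
  - have [|s scd Ds] := zero_at a; first by rewrite a0 lexx.
    exists a; split; first by rewrite /= in_itv /= a0 lexx.
    by apply: (mem _ a s); rewrite ?a0 ?lexx// oppr_le0 ha.
rewrite /= oppr_le0 in h2; rewrite {}t11 {}t12 /= in D1 h1 D2 h2.
rewrite /= !in_itv /= in ta * => s1cd s2cd.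
suff [s [scd Ds hs]] : exists s, [/\ c <= s <= d, D (t, s) = 0 & h (t, s) = 0].
  by exists t, s; split.
have between x y : c <= x <= d -> c <= y <= d -> D (t, x) = 0 -> D (t, y) = 0 ->
    forall s, x <= s <= y -> c <= s <= d /\ D (t, s) = 0.
  move=> /andP[cx xd] /andP[cy yd] Dx Dy s /andP[xs sy].
  have scd : c <= s <= d by rewrite (le_trans cx xs) (le_trans sy yd).
  split=> //; move: scd => /andP[cs sd]; apply/eqP; rewrite eq_le -{1}Dy -Dx.
  by rewrite !Dmono.
have hline : continuous (fun s => h (t, s)).
  by move=> s; apply: continuous_comp; [exact: pair_cont|exact: hcont].
have [s12|s21] := leP s1 s2.
  have [s sb hs] := IVT_continuous hline s12 h1 h2.
  by have [scd Ds] := between _ _ s1cd s2cd D1 D2 _ sb; exists s.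
have [||s sb /eqP] := IVT_continuous (cont_opp hline) (ltW s21).
- by rewrite oppr_le0.
- by rewrite oppr_ge0.
rewrite oppr_eq0 => /eqP hs.
by have [scd Ds] := between _ _ s2cd s1cd D2 D1 _ sb; exists s.
Qed.
End MovingKnife.

(** * Minima, maxima and the median of three reals *)

Ltac minmax :=
  try rewrite !(maxEle, minEle);
  (* Innermost comparisons are split first, so that every assumption produced is free of
     conditionals. *)
  repeat match goal with |- context [if ?a <= ?b then _ else _] =>
    lazymatch a with context [if _ then _ else _] => fail | _ =>
    lazymatch b with context [if _ then _ else _] => fail | _ =>
    case: (leP a b) => ? end end end.

Lemma max_mono (R : realType) (x y x' y' : R) :
  x <= x' -> y <= y' -> Num.max x y <= Num.max x' y'.
Proof. by move=> xx yy; rewrite ge_max !le_max xx yy orbT. Qed.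

Lemma min_mono (R : realType) (x y x' y' : R) :
  x <= x' -> y <= y' -> Num.min x y <= Num.min x' y'.
Proof. by move=> xx yy; rewrite le_min !ge_min xx yy orbT. Qed.

Section Median.
Variable R : realType.
Implicit Types x y z : R.

(** The number [z] clamped between the minimum and the maximum of [x] and [y]; in this form
    monotonicity and continuity are inherited from min and max. *)
Definition med x y z := Num.max (Num.min x y) (Num.min (Num.max x y) z).

Lemma med_mono x y z x' y' z' :
  x <= x' -> y <= y' -> z <= z' -> med x y z <= med x' y' z'.
Proof.
move=> xx yy zz; apply: max_mono; first exact: min_mono.
by apply: min_mono => //; exact: max_mono.
Qed.

Lemma med_const x : med x x x = x.
Proof. by rewrite /med maxxx minxx maxxx. Qed.

Lemma med_opp x y z : med (- x) (- y) (- z) = - med x y z.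
Proof. by rewrite /med; minmax; lra. Qed.

(** With median 0, at most one of the numbers is positive and at most one is negative, so any two of
    them have weakly opposite signs. *)
Lemma med_eq0 x y z : med x y z = 0 ->
  [/\ (0 <= x /\ y <= 0) \/ (x <= 0 /\ 0 <= y),
      (0 <= x /\ z <= 0) \/ (x <= 0 /\ 0 <= z)
    & (0 <= y /\ z <= 0) \/ (y <= 0 /\ 0 <= z)].
Proof.
by rewrite /med; minmax => *; split; (have [|] := leP x 0); lra.
Qed.

End Median.

(** * Assigning three shares to three agents *)

Definition k0 : 'I_3 := @Ordinal 3 0 isT.
Definition k1 : 'I_3 := @Ordinal 3 1 isT.
Definition k2 : 'I_3 := @Ordinal 3 2 isT.

Lemma I3_ind (P : 'I_3 -> Prop) : P k0 -> P k1 -> P k2 -> forall i, P i.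
Proof.
move=> p0 p1 p2 [[|[|[|//]]] i3].
- by rewrite (_ : Ordinal i3 = k0) //; exact: val_inj.
- by rewrite (_ : Ordinal i3 = k1) //; exact: val_inj.
- by rewrite (_ : Ordinal i3 = k2) //; exact: val_inj.
Qed.

Definition triple T (x y z : T) (i : 'I_3) : T := nth x [:: x; y; z] i.

Lemma triple_inj (T : eqType) (x y z : T) :
  x != y -> x != z -> y != z -> injective (triple x y z).
Proof.
move=> xy xz yz; apply: I3_ind; apply: I3_ind => //= /eqP;
  by rewrite /triple /= ?(negPf xy, negPf xz, negPf yz) // eq_sym
    ?(negPf xy, negPf xz, negPf yz).
Qed.

Section Assignment.
Variable R : realType.

(** Here and below, [V i k] stands for the value of share [k] to agent [i]. *)
Definition lean (V : 'I_3 -> 'I_3 -> R) : R :=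
  med (V k0 k1 - V k0 k2) (V k1 k1 - V k1 k2) (V k2 k1 - V k2 k2).

Definition gain (V : 'I_3 -> 'I_3 -> R) (i : 'I_3) : R :=
  V i k0 - Num.max (V i k1) (V i k2).

Definition max_gain V : R :=
  Num.max (gain V k0) (Num.max (gain V k1) (gain V k2)).

(* An agent of gain [0] takes share 0; as [lean V = 0], the other two can be
   assigned shares 1 and 2, which they like at least as much as share 0. *)
Lemma envy_free_assignment V : lean V = 0 -> max_gain V = 0 ->
  exists s : 'I_3 -> 'I_3, injective s /\ forall i k, V i k <= V i (s i).
Proof.
move=> /med_eq0[m01 m02 m12] g0.
have le_gain i : gain V i <= 0.
  by move: i; apply: I3_ind; rewrite -g0 /max_gain !le_max lexx ?orbT.
have [i gi] : exists i, gain V i = 0.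
  move: g0; rewrite /max_gain; minmax => g0; by [exists k0|exists k1|exists k2].
have le_other j : V j k0 <= V j k1 \/ V j k0 <= V j k2.
  have := le_gain j; rewrite /gain subr_le0 le_max => /orP[]; by [left|right].
have other_le : V i k1 <= V i k0 /\ V i k2 <= V i k0.
  by apply/andP; rewrite -ge_max -subr_le0 -opprB oppr_le0 -/(gain V i) gi.
have l0 := le_other k0; have l1 := le_other k1; have l2 := le_other k2.
have ok x y z : x != y -> x != z -> y != z ->
    (forall k, V k0 k <= V k0 x) -> (forall k, V k1 k <= V k1 y) ->
    (forall k, V k2 k <= V k2 z) ->
  exists s : 'I_3 -> 'I_3, injective s /\ forall i k, V i k <= V i (s i).
  move=> xy xz yz Vx Vy Vz; exists (triple x y z); split; first exact: triple_inj.
  exact: I3_ind.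
move: i other_le {gi g0 le_gain}; apply: I3_ind => -[gi1 gi2].
- move=> {m01 m02 l0}; case: m12 => d; [apply: (ok k0 k1 k2)|apply: (ok k0 k2 k1)] => //;
    by apply: I3_ind => //; lra.
- move=> {m01 m12 l1}; case: m02 => d; [apply: (ok k1 k0 k2)|apply: (ok k2 k0 k1)] => //;
    by apply: I3_ind => //; lra.
- move=> {m02 m12 l2}; case: m01 => d; [apply: (ok k1 k2 k0)|apply: (ok k2 k1 k0)] => //;
    by apply: I3_ind => //; lra.
Qed.

Lemma lean_le V W : (forall i, V i k1 <= W i k1) -> (forall i, W i k2 <= V i k2) ->
  lean V <= lean W.
Proof. by move=> V1 V2; apply: med_mono; apply: lerB. Qed.

Lemma lean_le0 V : (forall i, V i k1 <= V i k2) -> lean V <= 0.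
Proof. by move=> V12; rewrite -(med_const 0); apply: med_mono; rewrite subr_le0. Qed.

Lemma lean_ge0 V : (forall i, V i k2 <= V i k1) -> 0 <= lean V.
Proof. by move=> V21; rewrite -(med_const 0); apply: med_mono; rewrite subr_ge0. Qed.

Lemma gain_le0 V i : V i k0 = 0 -> 0 <= V i k1 -> gain V i <= 0.
Proof. by move=> V0 V1; rewrite /gain V0 sub0r oppr_le0 le_max V1. Qed.

Lemma gain_ge0 V i : 0 <= V i k0 -> V i k1 = 0 -> V i k2 = 0 -> 0 <= gain V i.
Proof. by move=> V0 V1 V2; rewrite /gain V1 V2 maxxx subr0. Qed.

Section Knife.
Variables (V : R * R -> 'I_3 -> 'I_3 -> R) (a c d : R).
Hypothesis Vcont : forall i k, continuous (fun p => V p i k).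

Lemma lean_continuous : continuous (fun p => lean (V p)).
Proof. by rewrite /lean /med; continuity. Qed.

Lemma max_gain_continuous : continuous (fun p => max_gain (V p)).
Proof. by rewrite /max_gain /gain; continuity. Qed.

Lemma lean_zero t x y : x <= y -> lean (V (t, x)) <= 0 -> 0 <= lean (V (t, y)) ->
  exists2 s, x <= s <= y & lean (V (t, s)) = 0.
Proof.
move=> xy Vx Vy; apply: (@IVT_continuous _ (fun s => lean (V (t, s)))) => // s.
have pc : continuous (fun s : R => (t, s)) by continuity.
exact: (continuous_comp (pc s) (@lean_continuous _)).
Qed.

(** This is [moving_knife] for the median difference and the best advantage of share 0. At the final
    time it suffices that one agent, here [k0], has nonnegative gain, since [max_gain] is a maximum;
    at time 0 all gains must be nonpositive. *)
Lemma knife_assignment :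
  0 <= a -> c <= d ->
  (forall t s s' i, 0 <= t <= a -> c <= s -> s <= s' -> s' <= d ->
     V (t, s) i k1 <= V (t, s') i k1 /\ V (t, s') i k2 <= V (t, s) i k2) ->
  (forall t, 0 <= t <= a -> lean (V (t, c)) <= 0 <= lean (V (t, d))) ->
  (exists s, [/\ c <= s <= d, lean (V (0, s)) = 0 & forall i, gain (V (0, s)) i <= 0]) ->
  (forall s, c <= s <= d -> 0 <= gain (V (a, s)) k0) ->
  exists t s f, [/\ 0 <= t <= a, c <= s <= d, injective f
    & forall i k, V (t, s) i k <= V (t, s) i (f i)].
Proof.
move=> a0 cd mono ends [s0 [s0cd Ds0 gs0]] gend.
have [|||||t [s [ta scd Dts gts]]] :=
  @moving_knife R (fun p => lean (V p)) (fun p => max_gain (V p)) a c d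
    lean_continuous max_gain_continuous a0 cd.
- by move=> t s s' *; apply: lean_le => i; have [] := mono t s s' i.
- by move=> t /ends /andP[].
- by move=> t /ends /andP[].
- by exists s0 => //; split=> //; rewrite !ge_max !gs0.
- by move=> s scd; rewrite le_max gend.
have [f [finj fV]] := envy_free_assignment Dts gts.
by exists t, s, f.
Qed.

End Knife.
End Assignment.

(** * Points of the tangle: arcs [A] run from a to b, arcs [C] from b to c, arc [E] from a to c *)

Definition iA1 : 'I_5 := @Ordinal 5 0 isT.
Definition iA2 : 'I_5 := @Ordinal 5 1 isT.
Definition iC1 : 'I_5 := @Ordinal 5 2 isT.
Definition iC2 : 'I_5 := @Ordinal 5 3 isT.
Definition iE : 'I_5 := @Ordinal 5 4 isT.

Lemma I5_ind (P : 'I_5 -> Prop) : P iA1 -> P iA2 -> P iC1 -> P iC2 -> P iE ->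
  forall i, P i.
Proof.
move=> p0 p1 p2 p3 p4 [[|[|[|[|[|//]]]]] i5].
- by rewrite (_ : Ordinal i5 = iA1) //; exact: val_inj.
- by rewrite (_ : Ordinal i5 = iA2) //; exact: val_inj.
- by rewrite (_ : Ordinal i5 = iC1) //; exact: val_inj.
- by rewrite (_ : Ordinal i5 = iC2) //; exact: val_inj.
- by rewrite (_ : Ordinal i5 = iE) //; exact: val_inj.
Qed.

Section Lips.
Variable R : realType.
Implicit Types (x y : R) (i j : 'I_5).

(** Clamping extends the parametrization of each arc to a continuous map on the whole real line. *)
Definition clamp x : R := Num.max 0 (Num.min x 1).

Lemma clamp_itv x : clamp x \in (`[0, 1]%classic : set R).
Proof. by rewrite inE /= in_itv /= /clamp; minmax; lra. Qed.

Lemma clamp_id x : 0 <= x <= 1 -> clamp x = x.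
Proof. by rewrite /clamp; minmax; lra. Qed.

Definition unit_pt x : set_type (`[0, 1]%classic : set R) := exist _ (clamp x) (clamp_itv x).

Definition arc_pt i x : arcs R := existT _ i (unit_pt x).

Definition pt i x : lips R := \pi_(lips R) (arc_pt i x).

Lemma unit_pt_continuous : continuous unit_pt.
Proof.
apply/continuousP => _ [B Bopen <-].
have clamp_continuous : continuous clamp by rewrite /clamp; continuity.
by have /continuousP := clamp_continuous; exact.
Qed.

Lemma pt_continuous i : continuous (pt i).
Proof.
move=> x; apply: continuous_comp; last exact: pi_continuous.
by apply: continuous_comp; [exact: unit_pt_continuous|exact: existT_continuous].
Qed.

Lemma set_val_itv (u : set_type (`[0, 1]%classic : set R)) : 0 <= set_val u <= 1.
Proof. by have /= := set_valP u; rewrite in_itv. Qed.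

Lemma unit_pt_val u : unit_pt (set_val u) = u.
Proof. by apply: val_inj; rewrite /= clamp_id // set_val_itv. Qed.

Lemma set_val_unit_pt x : 0 <= x <= 1 -> set_val (unit_pt x) = x.
Proof. exact: clamp_id. Qed.

Lemma arc_pt_eta (p : arcs R) : arc_pt (tag p) (set_val (tagged p)) = p.
Proof. by case: p => i u; rewrite /arc_pt /= unit_pt_val. Qed.

Lemma pt_repr (y : lips R) :
  pt (tag (repr y)) (set_val (tagged (repr y))) = y.
Proof. by rewrite /pt arc_pt_eta reprK. Qed.

Lemma pt_surj (y : lips R) : exists i x, 0 <= x <= 1 /\ y = pt i x.
Proof.
exists (tag (repr y)), (set_val (tagged (repr y))).
by rewrite set_val_itv pt_repr.
Qed.

Lemma pi_eqP (p q : arcs R) :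
  \pi_(lips R) p = \pi_(lips R) q <->
  p = q \/ (arc_vertex p <> None /\ arc_vertex p = arc_vertex q).
Proof.
split=> [/eqquotP /asboolP //|pq].
by apply/eqquotP/asboolP.
Qed.

Definition vertex i x : option lips_vertex :=
  if x == 0 then Some (arc_src i) else if x == 1 then Some (arc_tgt i) else None.

Lemma arc_vertex_pt i x : 0 <= x <= 1 -> arc_vertex (arc_pt i x) = vertex i x.
Proof. by move=> x01; rewrite /arc_vertex set_val_unit_pt. Qed.

Lemma pt_glue i j x y : 0 <= x <= 1 -> 0 <= y <= 1 ->
  vertex i x <> None -> vertex i x = vertex j y -> pt i x = pt j y.
Proof. by move=> x01 y01 Ni ij; apply/pi_eqP; right; rewrite !arc_vertex_pt. Qed.

Lemma vertexP i x : vertex i x <> None -> x = 0 \/ x = 1.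
Proof. by rewrite /vertex; have [->|_] := eqVneq x 0; [left|have [->|//] := eqVneq x 1; right]. Qed.

Lemma pt_inj i j x y : 0 <= x <= 1 -> 0 <= y <= 1 -> pt i x = pt j y ->
  (i = j /\ x = y) \/ (vertex i x <> None /\ vertex i x = vertex j y).
Proof.
move=> x01 y01 /pi_eqP; rewrite !arc_vertex_pt // => -[e|]; last by right.
left; split; first by have /= := congr1 tag e.
have /= := congr1 (fun p : arcs R => set_val (tagged p)) e.
by rewrite !set_val_unit_pt.
Qed.

(** These seven identifications fix one representative per vertex: [pt iA1 0] for a, [pt iA1 1] for
    b and [pt iE 1] for c. *)
Lemma ptA0 : pt iA2 0 = pt iA1 0.
Proof. by apply: pt_glue; rewrite /vertex ?lexx ?ler01 ?eqxx. Qed.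

Lemma ptE0 : pt iE 0 = pt iA1 0.
Proof. by apply: pt_glue; rewrite /vertex ?lexx ?ler01 ?eqxx. Qed.

Lemma ptA1 : pt iA2 1 = pt iA1 1.
Proof. by apply: pt_glue; rewrite /vertex ?lexx ?ler01 ?eqxx ?oner_eq0. Qed.

Lemma ptB1 : pt iC1 0 = pt iA1 1.
Proof. by apply: pt_glue; rewrite /vertex ?lexx ?ler01 ?eqxx ?oner_eq0. Qed.

Lemma ptB2 : pt iC2 0 = pt iA1 1.
Proof. by apply: pt_glue; rewrite /vertex ?lexx ?ler01 ?eqxx ?oner_eq0. Qed.

Lemma ptC1 : pt iC1 1 = pt iE 1.
Proof. by apply: pt_glue; rewrite /vertex ?lexx ?ler01 ?eqxx ?oner_eq0. Qed.

Lemma ptC2 : pt iC2 1 = pt iE 1.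
Proof. by apply: pt_glue; rewrite /vertex ?lexx ?ler01 ?eqxx ?oner_eq0. Qed.

Section Lift.
Variables (T : Type) (f : 'I_5 -> R -> T).
Hypotheses (fa1 : f iA2 0 = f iA1 0) (fa2 : f iE 0 = f iA1 0).
Hypotheses (fb1 : f iA2 1 = f iA1 1) (fb2 : f iC1 0 = f iA1 1) (fb3 : f iC2 0 = f iA1 1).
Hypotheses (fc1 : f iC1 1 = f iE 1) (fc2 : f iC2 1 = f iE 1).

(** The value is read off the representative chosen by [repr]. The seven compatibilities make [f]
    agree on glued endpoints, whence [glue_liftE]: the choice does not affect the value. *)
Definition glue_lift (y : lips R) : T :=
  f (tag (repr y)) (set_val (tagged (repr y))).

Let fv w := match w with VA => f iA1 0 | VB => f iA1 1 | VC => f iE 1 end.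

Let fvE i x w : vertex i x = Some w -> f i x = fv w.
Proof.
rewrite /vertex; have [->|_] := eqVneq x 0.
  by move=> [<-]; move: i; apply: I5_ind.
have [->|//] := eqVneq x 1.
by move=> [<-]; move: i; apply: I5_ind.
Qed.

Lemma glue_liftE i x : 0 <= x <= 1 -> glue_lift (pt i x) = f i x.
Proof.
move=> x01; rewrite /glue_lift; set p := repr _.
have px : pt (tag p) (set_val (tagged p)) = pt i x by exact: pt_repr.
have [[ip xp]|[]] := pt_inj (set_val_itv (tagged p)) x01 px; first by rewrite xp ip.
case vp : (vertex (tag p) (set_val (tagged p))) => [w|//] _ /esym vi.
by rewrite (fvE vp) (fvE vi).
Qed.

End Lift.

(** * Closed regions cut out by intervals *)

Lemma interval_regionE (z : 'M[R]_(5, 2)) (y : lips R) : interval_region z y <->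
  exists i x, [/\ 0 <= x <= 1, z i 0 <= x <= z i 1 & y = pt i x].
Proof.
split=> [[p /= zp <-]|[i [x [x01 zx ->]]]].
  exists (tag p), (set_val (tagged p)); split=> //; first exact: set_val_itv.
  by rewrite /pt arc_pt_eta.
by exists (arc_pt i x) => //=; rewrite set_val_unit_pt.
Qed.

(** By the quotient and sum topologies, closedness is tested on the preimage in each arc. *)
Lemma interval_region_closed (z : 'M[R]_(5, 2)) : closed (interval_region z).
Proof.
rewrite -[X in closed X]setCK; apply: open_closedC.
rewrite /open /= /quotient_open; apply/sigT_openP => i.
pose F : set R := [set x | 0 <= x <= 1 /\ interval_region z (pt i x)].
have Fclosed : closed F.
  (* Beyond the interval of row [i], gluing can add only endpoints of the arc, a finite set. *)
  suff -> : F = `[Num.max 0 (z i 0), Num.min 1 (z i 1)]%classic `|` (F `&` [set 0; 1]).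
    apply: closedU; first exact: (compact_closed (@Rhausdorff R) (@segment_compact _ _ _)).
    have /accessible_finite_set_closed := hausdorff_accessible (@Rhausdorff R).
    by apply; apply: finite_setIr; exact: finite_set2.
  apply/seteqP; split=> x /=.
    move=> [x01 zx]; have /interval_regionE [j [y [y01 zy ixjy]]] := zx.
    have [[ij xy]|[/vertexP v _]] := pt_inj x01 y01 ixjy; last by right.
    by left; rewrite in_itv /= ge_max le_min andbACA x01 ij xy.
  rewrite in_itv /= ge_max le_min andbACA => -[/andP[x01 zx]|[]//].
  by split=> //; apply/interval_regionE; exists i, x.
exists (~` F); first exact: closed_openC.
apply/seteqP; split=> u /= Hu zu; apply: Hu.
  split; first exact: set_val_itv.
  by rewrite /pt /arc_pt unit_pt_val.
by case: zu => _; rewrite /pt /arc_pt unit_pt_val.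
Qed.

(* Lists the intervals cut out on the two arcs [a b] (the same one), on each of
   the two arcs [b c], and on the arc [a c]. *)
Definition box (a c1 c2 e : R * R) : 'M[R]_(5, 2) :=
  \matrix_(i, j) let p := nth a [:: a; a; c1; c2; e] i in
    if j == 0 then p.1 else p.2.

Lemma mx_continuous (T : topologicalType) m n (z : T -> 'M[R]_(m, n)) :
  (forall (i : 'I_m) (j : 'I_n), continuous (fun t => z t i j)) -> continuous z.
Proof.
move=> zc t A [P nP PA]; rewrite /nbhs /=.
suff : \forall t' \near t, forall (i : 'I_m) (j : 'I_n), P i j (z t' i j).
  by apply: filterS => t' Pt'; exact: PA.
apply: filter_forall => i; apply: filter_forall => j.
by apply: zc; exact: nP.
Qed.

Lemma box_continuous (T : topologicalType) (a c1 c2 e : T -> R * R) :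
  continuous a -> continuous c1 -> continuous c2 -> continuous e ->
  continuous (fun t => box (a t) (c1 t) (c2 t) (e t)).
Proof.
move=> ac c1c c2c ec; apply: mx_continuous => i j.
under eq_fun do rewrite mxE.
by move: i; case: (j == 0); apply: I5_ind; first [exact: cont_fst|exact: cont_snd].
Qed.

Definition region a c1 c2 e : set (lips R) := interval_region (box a c1 c2 e).

Definition sub_itv (p q : R * R) := q.1 <= p.1 /\ p.2 <= q.2.

Lemma regionP a c1 c2 e q : region a c1 c2 e q <->
  exists x, 0 <= x <= 1 /\
  [\/ a.1 <= x <= a.2 /\ (q = pt iA1 x \/ q = pt iA2 x),
      c1.1 <= x <= c1.2 /\ q = pt iC1 x,
      c2.1 <= x <= c2.2 /\ q = pt iC2 x
    | e.1 <= x <= e.2 /\ q = pt iE x].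
Proof.
split=> [/interval_regionE[i [x [x01 + ->]]]|[x [x01 H]]].
  rewrite !mxE /= => zx; exists x; split=> //; move: i zx.
  apply: I5_ind => /= zx.
  - by apply: Or41; split=> //; left.
  - by apply: Or41; split=> //; right.
  - exact: Or42.
  - exact: Or43.
  - exact: Or44.
apply/interval_regionE.
case: H => -[zx].
- by case=> ->; [exists iA1, x|exists iA2, x]; rewrite !mxE.
- by move=> ->; exists iC1, x; rewrite !mxE.
- by move=> ->; exists iC2, x; rewrite !mxE.
- by move=> ->; exists iE, x; rewrite !mxE.
Qed.

End Lips.

(** * Connectedness and values of shares *)

Section Shares.
Variable R : realType.
Implicit Types (nu : set (lips R) -> R) (X T : set (lips R)).

(** [X] is then the component of [p]. This also covers empty regions: for [p] outside [X] the
    component is empty. *)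
Lemma connected_hub X p : (forall q, X q -> connected_component X p q) -> connected X.
Proof.
move=> Xp; suff -> : X = connected_component X p by exact: component_connected.
by apply/seteqP; split=> // q /connected_component_sub.
Qed.

Lemma pt_linked X i (x x' : R) :
  (forall y, Num.min x x' <= y <= Num.max x x' -> X (pt i y)) ->
  connected_component X (pt i x) (pt i x').
Proof.
move=> Xi; exists (pt i @` `[Num.min x x', Num.max x x']); last first.
  by exists x' => //=; rewrite in_itv /= ge_min le_max !lexx !orbT.
split.
- by exists x => //=; rewrite in_itv /= ge_min le_max !lexx.
- by move=> _ [y /= + <-]; rewrite in_itv /=; exact: Xi.
apply: connected_continuous_connected; first exact: segment_connected.
exact/continuous_subspaceT/pt_continuous.
Qed.

Lemma region_linked (a c1 c2 e : R * R) (i : 'I_5) x x' :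
  let p := nth a [:: a; a; c1; c2; e] i in
  0 <= x <= 1 -> 0 <= x' <= 1 -> p.1 <= x <= p.2 -> p.1 <= x' <= p.2 ->
  connected_component (region a c1 c2 e) (pt i x) (pt i x').
Proof.
move=> p x01 x'01 px px'; apply: pt_linked => y; minmax => y01;
  by apply/interval_regionE; exists i, y; rewrite !mxE /= -/p; split=> //; lra.
Qed.

Lemma region_sub (a c1 c2 e a' c1' c2' e' : R * R) :
  sub_itv a a' -> sub_itv c1 c1' -> sub_itv c2 c2' -> sub_itv e e' ->
  region a c1 c2 e `<=` region a' c1' c2' e'.
Proof.
move=> [a1 a2] [c11 c12] [c21 c22] [e1 e2] q /regionP[x [x01 H]].
apply/regionP; exists x; split=> //.
by case: H => -[zx qE]; [apply: Or41|apply: Or42|apply: Or43|apply: Or44];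
  split=> //; lra.
Qed.

Lemma value_at0_le (F : R -> R) (l : R) : continuous F ->
  (forall t, 0 < t < 1 -> F t <= l) -> F 0 <= l.
Proof.
move=> Fc Fl; rewrite leNgt; apply/negP => lF0.
have : \forall t \near (0 : R), l < F t by apply: cvgr_gt (Fc 0) _ lF0.
move=> /nbhs_ballP[d /= d0 Fd].
pose t := Num.min (d / 2) 2^-1.
have t01 : 0 < t < 1 /\ t < d by rewrite /t; minmax; split; lra.
have [t0 td] := t01.
have := Fl t t0; rewrite leNgt => /negP; apply; apply: Fd.
by rewrite /ball /= sub0r normrN gtr0_norm //; lra.
Qed.

(** Interval regions are always closed, so a family of connected ones stays inside the domain on
    which [nu] is continuous. *)
Lemma nu_region_continuous nu (S : topologicalType) (z : S -> 'M[R]_(5, 2)) :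
  monotone_continuous nu -> continuous z ->
  (forall s, connected (interval_region (z s))) ->
  continuous (fun s => nu (interval_region (z s))).
Proof.
move=> [_ _ /subspace_continuousP nuc] zc zconn s.
have zs : closed (interval_region (z s)) /\ connected (interval_region (z s)).
  by split; [exact: interval_region_closed|].
apply: cvg_comp (nuc _ zs).
move=> A /= zA; apply: (@filterS S (nbhs s) _ _ _ _ (zc s _ zA)) => s' /=; apply.
by split; [exact: interval_region_closed|].
Qed.

(* Decreasing every right endpoint empties the region. *)
Lemma nu_degenerate nu (z : 'M[R]_(5, 2)) : monotone_continuous nu ->
  connected (interval_region z) -> (forall i, z i 1 <= z i 0) ->
  nu (interval_region z) = 0.
Proof.
move=> nuc zconn zdeg; have [nu0 _ _] := nuc.
(* The family is constantly [z] for [t <= 0] and gives the empty region for [t > 0]; it is thus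
   connected for every real [t], and the value at 0 is a limit of values of the empty set. *)
pose w (t : R) : 'M[R]_(5, 2) := \matrix_(i, j) (z i j - if j == 0 then 0 else Num.max 0 t).
have wc : continuous w.
  apply: mx_continuous => i j; under eq_fun do rewrite mxE.
  have sub_cont : continuous (fun t : R => z i j - Num.max 0 t) by continuity.
  by case: (j == 0); [exact: cont_const|exact: sub_cont].
have w_empty t : 0 < t -> interval_region (w t) = set0.
  move=> t0; apply/seteqP; split=> // q /interval_regionE[i [x [_ + _]]].
  by rewrite !mxE /= subr0; have := zdeg i; minmax; lra.
have w_id t : t <= 0 -> w t = z.
  move=> t0; apply/matrixP => i j; rewrite mxE.
  by case: (j == 0); rewrite ?subr0 //; minmax; lra.
have nuwc : continuous (fun t => nu (interval_region (w t))).
  apply: nu_region_continuous => // t.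
  have [t0|t0] := leP t 0; first by rewrite w_id.
  by rewrite w_empty //; exact: connected0.
have nuw0 t : 0 < t < 1 -> nu (interval_region (w t)) = 0.
  by move=> /andP[t0 _]; rewrite w_empty.
rewrite -(w_id 0) //; apply/eqP; rewrite eq_le.
rewrite (value_at0_le nuwc) /=; last by move=> t /nuw0 ->.
rewrite -oppr_le0; apply: (@value_at0_le (fun t => - nu (interval_region (w t))) 0).
  exact: cont_opp.
by move=> t /nuw0 ->; rewrite oppr0.
Qed.

(** Two points of [T] lie together in one region with small [e], so [T] is connected. Its value lies
    between those of the regions with [e > 0] and that of the region with [e = 0], and the former
    tend to the latter. *)
Lemma share_limit T (z : R -> 'M[R]_(5, 2)) : continuous z ->
  (forall e, 0 <= e < 1 -> connected (interval_region (z e))) ->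
  (forall e e', 0 <= e -> e <= e' -> interval_region (z e') `<=` interval_region (z e)) ->
  (forall e, 0 < e < 1 -> interval_region (z e) `<=` T) ->
  (forall q, T q -> exists2 e, 0 < e < 1 & interval_region (z e) q) ->
  connected T /\ forall nu, monotone_continuous nu -> nu T = nu (interval_region (z 0)).
Proof.
move=> zc zconn zmono zT Tz.
have Tconn : connected T.
  (* Any point of [T] can be the hub; the default [pt iE 0] is taken only if [T] is empty. *)
  apply: (@connected_hub _ (xget (pt iE 0) T)) => q Tq.
  have := xgetPex (pt iE 0) (ex_intro _ q Tq); set p := xget _ _ => Tp.
  have [e1 e10 z1p] := Tz _ Tp; have [e2 e20 z2q] := Tz _ Tq.
  have e0 : 0 < Num.min e1 e2 < 1 by minmax; lra.
  exists (interval_region (z (Num.min e1 e2))); last first.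
    by apply: zmono z2q; rewrite ?ge_min ?lexx ?orbT//; lra.
  split; last by apply: zconn; lra.
    by apply: zmono z1p; rewrite ?ge_min ?lexx ?orbT//; lra.
  exact: zT.
split=> // nu nuc; have [nu0 nu_mono _] := nuc.
have T_sub : T `<=` interval_region (z 0).
  by move=> q /Tz[e e01 zq]; apply: zmono zq => //; lra.
have z0conn : connected (interval_region (z 0)) by apply: zconn; lra.
apply/eqP; rewrite eq_le nu_mono //=.
(* Truncating [e] to the interval from 0 to 1/2 makes the family connected for every real
   parameter. *)
pose F e := nu (interval_region (z (Num.max 0 (Num.min e 2^-1)))).
have F0 : F 0 = nu (interval_region (z 0)).
  by rewrite /F; congr (nu (interval_region (z _))); minmax; lra.
have Fc : continuous F.
  apply: nu_region_continuous => //; last by move=> e; apply: zconn; minmax; lra.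
  have clampc : continuous (fun e : R => Num.max 0 (Num.min e 2^-1)) by continuity.
  by move=> e; exact: (continuous_comp (clampc e) (zc _)).
rewrite -F0; apply: value_at0_le => // t t01; apply: nu_mono => //.
  by apply: zconn; minmax; lra.
by apply: zT; minmax; lra.
Qed.

(** Shares are presented as the fibres of a map [c], which makes them disjoint and covering at
    once. *)
Lemma envy_free_exists (nu : 'I_3 -> set (lips R) -> R) (c : lips R -> 'I_3)
    (f : 'I_3 -> 'I_3) : injective f ->
  (forall k, connected [set q | c q = k]) ->
  (forall i k, nu i [set q | c q = k] <= nu i [set q | c q = f i]) ->
  exists T : 'I_3 -> set (lips R), connected_allocation T /\ envy_free nu T.
Proof.
move=> finj conn nuf; exists (fun i => [set q | c q = f i]); split.
  split=> [i||]; first exact: conn.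
  - by move=> i j _ _ [q [/= ci cj]]; apply: finj; rewrite -ci.
  - apply/seteqP; split=> // q _; have [g _ gK] := injF_bij finj.
    by exists (g (c q)) => //=; rewrite gK.
by move=> i j; exact: nuf.
Qed.

End Shares.

(** * Division along a trail *)

Section StringCase.
Variable R : realType.
Implicit Types (al be : R) (q : lips R).

(* The tangle read along the trail c - a = b - c - b (both arcs [a b] run
   through simultaneously), with parameter [1] at a, [2] at b and [3] at c. *)
Definition string_box al be : 'M[R]_(5, 2) :=
  box (al - 1, be - 1) (al - 2, be - 2) (4 - be, 4 - al) (1 - be, 1 - al).

(** The trail passes c at 0 and 3, and b at 2 and 4. The conditionals place c at 3 and b at 2, so
    all positions lie strictly between 0 and 4. *)
Definition string_coord (i : 'I_5) (x : R) : R :=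
  match val i with
  | 0%N | 1%N => 1 + x
  | 2%N => 2 + x
  | 3%N => if x == 0 then 2 else 4 - x
  | _ => if x == 1 then 3 else 1 - x
  end.

Lemma itv_neq0 (x : R) : 0 <= x <= 1 -> x != 0 -> 0 < x.
Proof. by move=> /andP[x0 _] xN0; rewrite lt_neqAle eq_sym xN0. Qed.

Lemma itv_neq1 (x : R) : 0 <= x <= 1 -> x != 1 -> x < 1.
Proof. by move=> /andP[_ x1] xN1; rewrite lt_neqAle xN1. Qed.

Definition string_pos q : R := glue_lift string_coord q.

Lemma string_posE i x : 0 <= x <= 1 -> string_pos (pt i x) = string_coord i x.
Proof.
by apply: glue_liftE; rewrite /string_coord /= ?eqxx ?oner_eq0 ?[0 == 1]eq_sym ?oner_eq0 //=; lra.
Qed.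

Lemma string_pos_itv q : 0 < string_pos q < 4.
Proof.
have [i [x [x01 ->]]] := pt_surj q; rewrite string_posE // /string_coord.
move: i; apply: I5_ind => /=; try lra.
  by have [|/(itv_neq0 x01)] := eqVneq x 0; lra.
by have [|/(itv_neq1 x01)] := eqVneq x 1; lra.
Qed.

(** The bounds on [al] and [be] exclude the two ends of the trail, where c and b occur at positions
    other than [string_pos]. *)
Lemma string_region al be q : 0 < al -> be < 4 ->
  interval_region (string_box al be) q <-> al <= string_pos q <= be.
Proof.
move=> al0 be4; split.
  move=> /regionP[x [x01 [[/= zx [->|->]]|[/= zx ->]|[/= zx ->]|[/= zx ->]]]];
    rewrite string_posE // /string_coord /=; try lra.
    by have [|_] := eqVneq x 0; lra.
  by have [|_] := eqVneq x 1; lra.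
have [i [x [x01 ->]]] := pt_surj q; rewrite string_posE // /string_coord.
move: i; apply: I5_ind => /= sx; apply/regionP.
- by exists x; split=> //; apply: Or41; rewrite /=; split; [lra|left].
- by exists x; split=> //; apply: Or41; rewrite /=; split; [lra|right].
- by exists x; split=> //; apply: Or42; rewrite /=; split; [lra|].
- have [x0|x0] := eqVneq x 0; move: sx; rewrite ?x0 ?eqxx ?(negPf x0) => sx.
    exists 0; rewrite lexx ler01; split=> //; apply: Or42; split; first by rewrite /=; lra.
    by rewrite ptB1 ptB2.
  by exists x; split=> //; apply: Or43; rewrite /=; split; [lra|].
- have [x1|x1] := eqVneq x 1; move: sx; rewrite ?x1 ?eqxx ?(negPf x1) => sx.
    exists 1; rewrite lexx ler01; split=> //; apply: Or42; split; first by rewrite /=; lra.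
    by rewrite ptC1.
  by exists x; split=> //; apply: Or44; rewrite /=; split; [lra|].
Qed.

Lemma string_box_continuous (T : topologicalType) (f g : T -> R) :
  continuous f -> continuous g -> continuous (fun t => string_box (f t) (g t)).
Proof. by move=> fc gc; apply: box_continuous; continuity. Qed.

Lemma string_box_sub al be al' be' : al' <= al -> be <= be' ->
  interval_region (string_box al be) `<=` interval_region (string_box al' be').
Proof. by move=> aa bb; apply: region_sub; split=> /=; lra. Qed.

Let trans := connected_component_trans.

(** The hypothesis rules out an interval strictly inside the doubled arcs, which would have two
    pieces. Otherwise a vertex a, b or c met by the interval serves as hub, or the interval lies in
    a single arc. *)
Lemma string_connected al be : al <= 1 \/ 2 <= be ->
  connected (interval_region (string_box al be)).
Proof.
move=> albe; set X := interval_region _.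
have link (i : 'I_5) x x' : let p := nth (al - 1, be - 1) [:: (al - 1, be - 1);
    (al - 1, be - 1); (al - 2, be - 2); (4 - be, 4 - al); (1 - be, 1 - al)] i in
    0 <= x <= 1 -> 0 <= x' <= 1 -> p.1 <= x <= p.2 -> p.1 <= x' <= p.2 ->
  connected_component X (pt i x) (pt i x') by exact: region_linked.
have [beal|albe'] := ltP be al.
  rewrite (_ : X = set0); first exact: connected0.
  apply/seteqP; split=> // q.
  by move=> /regionP[x [x01 [[/= zx _]|[/= zx _]|[/= zx _]|[/= zx _]]]]; lra.
have BC : 3 <= be -> al <= 2 -> connected_component X (pt iA1 1) (pt iE 1).
  by move=> *; rewrite -ptB1 -ptC1; apply: link => /=; lra.
have [be1|be1] := ltP be 1.
  apply: (@connected_hub _ _ (pt iE (1 - be))).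
  move=> q /regionP[x [x01 [[/= zx [->|->]]|[/= zx ->]|[/= zx ->]|[/= zx ->]]]]; try lra.
  by apply: link => /=; lra.
have [al1|al1] := leP al 1.
  apply: (@connected_hub _ _ (pt iA1 0)).
  have AB : 2 <= be -> connected_component X (pt iA1 0) (pt iA1 1).
    by move=> *; apply: link => /=; lra.
  move=> q /regionP[x [x01 [[/= zx [->|->]]|[/= zx ->]|[/= zx ->]|[/= zx ->]]]].
  - by apply: link => /=; lra.
  - by rewrite -ptA0; apply: link => /=; lra.
  - apply: trans (AB _) _; first lra.
    by rewrite -ptB1; apply: link => /=; lra.
  - apply: trans (AB _) _; first lra.
    apply: trans (BC _ _) _; try lra.
    by rewrite -ptC2; apply: link => /=; lra.
  - by rewrite -ptE0; apply: link => /=; lra.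
have [al2|al2] := leP al 2.
  apply: (@connected_hub _ _ (pt iA1 1)).
  move=> q /regionP[x [x01 [[/= zx [->|->]]|[/= zx ->]|[/= zx ->]|[/= zx ->]]]]; try lra.
  - by apply: link => /=; lra.
  - by rewrite -ptA1; apply: link => /=; lra.
  - by rewrite -ptB1; apply: link => /=; lra.
  - apply: trans (BC _ _) _; try lra.
    by rewrite -ptC2; apply: link => /=; lra.
have [be3|be3] := ltP be 3.
  apply: (@connected_hub _ _ (pt iC1 (al - 2))).
  move=> q /regionP[x [x01 [[/= zx [->|->]]|[/= zx ->]|[/= zx ->]|[/= zx ->]]]]; try lra.
  by apply: link => /=; lra.
have [al3|al3] := leP al 3.
  apply: (@connected_hub _ _ (pt iE 1)).
  move=> q /regionP[x [x01 [[/= zx [->|->]]|[/= zx ->]|[/= zx ->]|[/= zx ->]]]]; try lra.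
  - by rewrite -ptC1; apply: link => /=; lra.
  - by rewrite -ptC2; apply: link => /=; lra.
apply: (@connected_hub _ _ (pt iC2 (4 - al))).
move=> q /regionP[x [x01 [[/= zx [->|->]]|[/= zx ->]|[/= zx ->]|[/= zx ->]]]]; try lra.
by apply: link => /=; lra.
Qed.

End StringCase.

Lemma small_pos (R : realType) (x y : R) : 0 < x -> 0 < y ->
  exists e, [/\ 0 < e < 1, e <= x & e <= y].
Proof.
move=> x0 y0; exists (Num.min 2^-1 (Num.min x y)).
by split; minmax; lra.
Qed.

Section StringDivision.
Variables (R : realType) (nu : 'I_3 -> set (lips R) -> R).
Hypotheses (nu_val : forall i, valuation (nu i))
  (nu_cont : forall i, monotone_continuous (nu i)).

Let S (al be : R) := interval_region (string_box al be).

Let nu_mono i al be al' be' : al <= 1 \/ 2 <= be -> al' <= 1 \/ 2 <= be' ->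
  al' <= al -> be <= be' -> nu i (S al be) <= nu i (S al' be').
Proof.
move=> c c' aa bb; have [_ mono _] := nu_cont i.
by apply: mono; [exact: string_connected..|exact: string_box_sub].
Qed.

Let nu_ge0 i al be : al <= 1 \/ 2 <= be -> 0 <= nu i (S al be).
Proof. by move=> c; apply: nu_val; exact: string_connected. Qed.

Let nu_pt i al : al <= 1 \/ 2 <= al -> nu i (S al al) = 0.
Proof.
move=> c; apply: nu_degenerate => //; first exact: string_connected.
by apply: I5_ind; rewrite !mxE /=; lra.
Qed.

Let string_shares (t s : R) (k : 'I_3) : set (lips R) :=
  triple (S 0 t) (S t s) (S s 4) k.

(** Both cut points go to share 1: with [t <= s = 2] it contains b, which joins its parts of the two
    arcs a b. *)
Let string_class (t s : R) (q : lips R) : 'I_3 :=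
  if string_pos q < t then k0 else if string_pos q <= s then k1 else k2.

Let string_share t s k : 0 <= t <= 4 -> 2 <= s <= 4 -> t <= s ->
  connected [set q | string_class t s q = k] /\
  forall i, nu i [set q | string_class t s q = k] = nu i (string_shares t s k).
Proof.
move=> t04 s24 ts.
(* For [0 < e < 1] these regions stay off the trail ends 0 and 4, as [string_region] requires, and
   off the open sides of shares 0 and 2. *)
pose z : 'I_3 -> R -> 'M[R]_(5, 2) := triple
  (fun e => string_box e (t - e))
  (fun e => string_box (Num.max t e) (Num.min s (4 - e)))
  (fun e => string_box (s + e) (4 - e)).
have z0 : interval_region (z k 0) = string_shares t s k.
  move: k; apply: I3_ind; rewrite /z /string_shares /triple /= ?subr0 ?addr0 //.
  by congr S; minmax; lra.
have [||||q kq|kconn kval] := @share_limit R [set q | string_class t s q = k] (z k).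
- move: {z0} k; apply: I3_ind.
  + by apply: (string_box_continuous (f := fun e => e) (g := fun e => t - e)); continuity.
  + by apply: (string_box_continuous (f := fun e => Num.max t e)
      (g := fun e => Num.min s (4 - e))); continuity.
  + by apply: (string_box_continuous (f := fun e => s + e) (g := fun e => 4 - e)); continuity.
- move=> e e01; move: {z0} k; apply: I3_ind; apply: string_connected;
    by minmax; lra.
- move=> e e' e0 ee'; move: {z0} k; apply: I3_ind; apply: string_box_sub;
    by minmax; lra.
- move=> e e01 q; move: {z0} k; apply: I3_ind => zq /=; rewrite /string_class.
  + have /andP[_ qt] : e <= string_pos q <= t - e by apply/string_region => //; lra.
    have {}qt : string_pos q < t by lra.
    by rewrite qt.
  + have : Num.max t e <= string_pos q <= Num.min s (4 - e).
      by apply/string_region => //; minmax; lra.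
    by rewrite ge_max le_min ltNge => /andP[/andP[-> _] /andP[-> _]].
  + have /andP[sq _] : s + e <= string_pos q <= 4 - e by apply/string_region => //; lra.
    have tq : t <= string_pos q by lra.
    have {}sq : s < string_pos q by lra.
    by rewrite ltNge tq leNgt sq.
- have := string_pos_itv q; move: {z0} k kq; apply: I3_ind; rewrite /= /string_class;
    (have [qt|tq] := ltP (string_pos q) t; last have [qs|sq] := leP (string_pos q) s) => // _ /andP[q0 q4].
  + have [||e [e01 eq etq]] := @small_pos _ (string_pos q) (t - string_pos q); try lra.
    by exists e => //; apply/string_region; lra.
  + have [||e [e01 eq e4q]] := @small_pos _ (string_pos q) (4 - string_pos q); try lra.
    by exists e => //; apply/string_region; minmax; lra.
  + have [||e [e01 esq e4q]] := @small_pos _ (string_pos q - s) (4 - string_pos q); try lra.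
    by exists e => //; apply/string_region; lra.
split=> // i; rewrite kval //; congr (nu i _); exact: z0.
Qed.

(** The second cut is forced past b, hence outside K, and past the first cut. This makes the shares
    connected for all real [t] and [s]. *)
Let cut (t s : R) := Num.max 2 (Num.max s t).

Let cut_ge t s : 2 <= cut t s /\ t <= cut t s.
Proof. by rewrite /cut; minmax; lra. Qed.

Let cut_le t s : 0 <= t <= 4 -> 2 <= s <= 4 -> cut t s <= 4.
Proof. by rewrite /cut; minmax; lra. Qed.

Let cut_eq4 t s : 0 <= t <= 4 -> 2 <= s <= 4 -> t = 4 \/ s = 4 -> cut t s = 4.
Proof. by rewrite /cut; minmax; lra. Qed.

Let cut_mono t s s' : s <= s' -> cut t s <= cut t s'.
Proof. by rewrite /cut; minmax; lra. Qed.

Let cut_2 t : cut t 2 = Num.max 2 t.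
Proof. by rewrite /cut; minmax; lra. Qed.

Let V (p : R * R) (i k : 'I_3) : R := nu i (string_shares p.1 (cut p.1 p.2) k).

Let Vcont i k : continuous (fun p => V p i k).
Proof.
have c0 : continuous (fun p : R * R => p.1) by continuity.
have c1 : continuous (fun p : R * R => cut p.1 p.2) by rewrite /cut; continuity.
move: k; apply: I3_ind; apply: nu_region_continuous => //;
  try by apply: string_box_continuous => //; exact: cont_const.
- by move=> p; apply: string_connected; left.
- by move=> p; apply: string_connected; right; have [] := cut_ge p.1 p.2.
- by move=> p; apply: string_connected; right; rewrite ler_nat.
Qed.

Let c24 : 2 <= (4 : R). Proof. by rewrite ler_nat. Qed.

Let V0 t s i : 0 <= V (t, s) i k0.
Proof. by apply: nu_ge0; left. Qed.

Let V1 t s i : 0 <= V (t, s) i k1.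
Proof. by apply: nu_ge0; right; have [] := cut_ge t s. Qed.

Let V2 t s i : 0 <= V (t, s) i k2.
Proof. by apply: nu_ge0; right. Qed.

Let V2_4 t s i : 0 <= t <= 4 -> 2 <= s <= 4 -> t = 4 \/ s = 4 -> V (t, s) i k2 = 0.
Proof. by move=> t04 s24 ts; rewrite /V /= cut_eq4 //; apply: nu_pt; right. Qed.

Let V1_4 s i : 2 <= s <= 4 -> V (4, s) i k1 = 0.
Proof.
move=> s24; rewrite /V /= cut_eq4 //; [by apply: nu_pt; right| |by left].
by rewrite lexx andbT.
Qed.

Lemma string_division :
  lean (fun i => nu i \o triple set0 (S 0 2) (S 2 4)) <= 0 ->
  exists T : 'I_3 -> set (lips R), connected_allocation T /\ envy_free nu T.
Proof.
move=> KC.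
have ends t : 0 <= t <= 4 -> lean (V (t, 2)) <= 0 <= lean (V (t, 4)).
  move=> t04; apply/andP; split; last first.
    by apply: lean_ge0 => i; rewrite V2_4 ?lexx ?andbT //; right.
  (* With the cut at b, share 2 consists of the two arcs b c and share 1 is part of K, so [KC]
     applies; once the first cut has passed b, share 1 is degenerate instead. *)
  have [t2|t2] := leP t 2.
    apply: le_trans KC; apply: lean_le => i; rewrite /V /= cut_2 max_l //.
      by apply: nu_mono => //; [right|right|case/andP: t04].
  apply: lean_le0 => i; rewrite /V /= cut_2 max_r; last exact: ltW.
  by rewrite nu_pt; [apply: nu_ge0; right|right; exact: ltW].
have t04 : 0 <= (0 : R) <= 4 by rewrite lexx ler0n.
(* Share 0 is degenerate at time 0, and both other shares are at time 4. *)
have [||||||t [s [f [{}t04 s24 finj fV]]]] := @knife_assignment R V 4 2 4 Vcont.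
- exact: ler0n.
- exact: c24.
- move=> t s x i _ _ sx _; have [s2 ts] := cut_ge t s; have [x2 tx] := cut_ge t x.
  by split; apply: nu_mono => //; try (by right); exact: cut_mono.
- exact: ends.
- have /andP[D2 D4] := ends _ t04.
  have [s s24 Ds0] := @lean_zero R V Vcont 0 2 4 c24 D2 D4.
  exists s; split=> // i; apply: gain_le0; last exact: V1.
  by apply: nu_pt; left.
- move=> s s24; apply: gain_ge0; [exact: V0|exact: V1_4|].
  by apply: V2_4; [rewrite lexx andbT| |left].
have [s2 ts] := cut_ge t s; have s4 := cut_le t04 s24.
have share k := @string_share t (cut t s) k t04 (introT andP (conj s2 s4)) ts.
apply: (@envy_free_exists _ _ (string_class t (cut t s)) f finj).
  by move=> k; have [] := share k.
by move=> i k; have [_ ->] := share k; have [_ ->] := share (f i); exact: fV.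
Qed.

End StringDivision.

(** * Transport along the symmetry of the tangle *)

Section Reflection.
Variable R : realType.

Definition flip (i : 'I_5) : 'I_5 :=
  match val i with 0%N => iC1 | 1%N => iC2 | 2%N => iA1 | 3%N => iA2 | _ => iE end.

Lemma flipK : involutive flip.
Proof. exact: I5_ind. Qed.

(* The symmetry of the tangle exchanging a and c. *)
Definition reflect_lips : lips R -> lips R := glue_lift (fun i x => pt (flip i) (1 - x)).

Lemma reflect_pt i x : 0 <= x <= 1 -> reflect_lips (pt i x) = pt (flip i) (1 - x).
Proof.
apply: glue_liftE; rewrite /flip /= ?subr0 ?subrr ?ptA0 ?ptE0 ?ptA1 ?ptB1 ?ptB2 ?ptC1 ?ptC2 //.
Qed.

Lemma reflect_lipsK : involutive reflect_lips.
Proof.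
move=> q; have [i [x [x01 ->]]] := pt_surj q.
by rewrite !reflect_pt ?flipK ?subKr //; lra.
Qed.

(** Continuity on the quotient is checked on each arc, where the map is a reversal followed by
    [pt]. *)
Lemma reflect_lips_continuous : continuous reflect_lips.
Proof.
apply/quotient_continuous.
move=> [i u]; suff fiber_cont : continuous (fun v : set_type (`[0, 1]%classic : set R) =>
  reflect_lips (\pi_(lips R) (existT _ i v))) by exact: fiber_cont.
rewrite (_ : (fun _ => _) = (fun v => pt (flip i) (1 - set_val v))).
  have val_cont : continuous (fun v : set_type (`[0, 1]%classic : set R) => set_val v : R).
    exact: initial_continuous.
  have sub_cont : continuous (fun v : set_type (`[0, 1]%classic : set R) => 1 - set_val v : R).
    by continuity.
  by move=> v; exact: (continuous_comp (sub_cont v) (@pt_continuous _ (flip i) _)).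
by apply/funext => v; rewrite -reflect_pt ?set_val_itv // /pt /arc_pt unit_pt_val.
Qed.

Lemma reflect_connected (X : set (lips R)) :
  connected X -> connected (reflect_lips @` X).
Proof.
move=> Xconn; apply: connected_continuous_connected => //.
exact/continuous_subspaceT/reflect_lips_continuous.
Qed.

Definition reflect_mx (z : 'M[R]_(5, 2)) : 'M[R]_(5, 2) :=
  \matrix_(i, j) if j == 0 then 1 - z (flip i) 1 else 1 - z (flip i) 0.

Lemma reflect_region (z : 'M[R]_(5, 2)) :
  reflect_lips @` interval_region z = interval_region (reflect_mx z).
Proof.
apply/seteqP; split=> q.
  move=> [_ /interval_regionE[i [x [x01 zx ->]]] <-].
  rewrite reflect_pt //; apply/interval_regionE; exists (flip i), (1 - x).
  by rewrite !mxE flipK /=; split=> //; lra.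
move=> /interval_regionE[i [x [x01 + ->]]]; rewrite !mxE /= => zx.
exists (pt (flip i) (1 - x)); last by rewrite reflect_pt ?flipK ?subKr //; lra.
by apply/interval_regionE; exists (flip i), (1 - x); split=> //; lra.
Qed.

Lemma reflect_mx_continuous : continuous reflect_mx.
Proof.
apply: mx_continuous => i j; under eq_fun do rewrite mxE.
have coord k : continuous (fun z : 'M[R]_(5, 2) => 1 - z (flip i) k).
  have := @coord_continuous R 5 2 (flip i) k; continuity.
by case: (j == 0); exact: coord.
Qed.

Definition reflect_nu (nu : set (lips R) -> R) (X : set (lips R)) := nu (reflect_lips @` X).

Lemma reflect_valuation nu : valuation nu -> valuation (reflect_nu nu).
Proof. by move=> nuv X Xconn; apply: nuv; exact: reflect_connected. Qed.

(** Reflection sends interval regions to interval regions through the continuous map [reflect_mx],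
    so continuity of [nu] is inherited by composition. *)
Lemma reflect_monotone_continuous nu :
  monotone_continuous nu -> monotone_continuous (reflect_nu nu).
Proof.
move=> [nu0 mono /subspace_continuousP nuc]; split.
- by rewrite /reflect_nu image_set0.
- by move=> X Y Xc Yc XY; apply: mono; [exact: reflect_connected..|exact: image_subset].
apply/subspace_continuousP => z [zcl zconn].
have dom w : closed (interval_region w) /\ connected (interval_region w) ->
    closed (interval_region (reflect_mx w)) /\ connected (interval_region (reflect_mx w)).
  move=> [_ wconn]; split; first exact: interval_region_closed.
  by rewrite -reflect_region; exact: reflect_connected.
have -> : (fun w => reflect_nu nu (interval_region w)) =
    (fun w => nu (interval_region (reflect_mx w))).
  by apply/funext => w; rewrite /reflect_nu reflect_region.
apply: cvg_comp (nuc _ (dom _ (conj zcl zconn))).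
move=> A zA; apply: (@filterS _ (nbhs z) _ _ _ _ (reflect_mx_continuous zA)).
by move=> w /= wA /dom; exact: wA.
Qed.

Lemma reflect_allocation (nu : 'I_3 -> set (lips R) -> R) :
  (exists T, connected_allocation T /\ envy_free (fun i => reflect_nu (nu i)) T) ->
  exists T : 'I_3 -> set (lips R), connected_allocation T /\ envy_free nu T.
Proof.
move=> [T [[Tconn Tdisj Tcov] Tenvy]]; exists (fun i => reflect_lips @` T i).
split; last by move=> i j; exact: Tenvy.
split=> [i||].
- exact: reflect_connected.
- move=> i j _ _ [_ [[q Tq <-] [q' Tq']]] /(can_inj reflect_lipsK) qq'.
  by apply: Tdisj => //; exists q; split=> //; rewrite -qq'.
apply/seteqP; split=> // q _; have : (\bigcup_i T i) (reflect_lips q) by rewrite Tcov.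
by move=> [i _ Tq]; exists i => //; exists (reflect_lips q) => //; exact: reflect_lipsK.
Qed.

End Reflection.

(** * Division with share 0 growing from b *)

Section RingCase.
Variable R : realType.
Implicit Types (u v sg e t s x : R) (q : lips R).

(* The tangle read along the loop b - c - a = b (both arcs [b c], then both arcs
   [a b], run through simultaneously), with parameter [0] at b, [1] at c and
   [2] at a. *)
Definition ring_coord (i : 'I_5) x : R :=
  match val i with
  | 0%N | 1%N => if x == 1 then 0 else 2 + x
  | 2%N | 3%N => x
  | _ => 2 - x
  end.

Definition ring_pos q : R := glue_lift ring_coord q.

Lemma ring_posE i x : 0 <= x <= 1 -> ring_pos (pt i x) = ring_coord i x.
Proof.
by apply: glue_liftE; rewrite /ring_coord /= ?eqxx ?oner_eq0 ?[0 == 1]eq_sym ?oner_eq0 //=; lra.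
Qed.

(* Share 0 contains b and extends by [u] towards c and by [v] towards (and
   beyond) a; the point [sg] of the arc [a c] separates share 2, on the side of
   c, from share 1, on the side of a. *)
Definition hub_box u v : 'M[R]_(5, 2) := box (1 - v, 1) (0, u) (0, u) (0, v - 1).

(** The margin [e] opens the sides facing share 0 and [sg]; [(1, 0)] is an empty row. The maximum
    with 0 keeps a in the last row until share 0 comes within [e] of it. *)
Definition a_box v sg e : 'M[R]_(5, 2) :=
  box (0, 1 - v - e) (1, 0) (1, 0) (v - 1 + e, Num.max (sg - e) 0).

(** The lower bounds of the last row are the cut, a margin from a and a margin from share 0 beyond
    a. The upper bound drops below 1, excluding c, exactly when [u + e > 1]. *)
Definition c_box u v sg e : 'M[R]_(5, 2) :=
  box (1, 0) (u + e, 1) (u + e, 1) (Num.max sg (Num.max e (v - 1 + e)), 2 - u - e).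

Section BoxContinuity.
Variables (T : topologicalType) (u v sg e : T -> R).
Hypotheses (uc : continuous u) (vc : continuous v) (sgc : continuous sg) (ec : continuous e).

Lemma hub_box_continuous : continuous (fun p => hub_box (u p) (v p)).
Proof. by rewrite /hub_box; apply: box_continuous; continuity. Qed.

Lemma a_box_continuous : continuous (fun p => a_box (v p) (sg p) (e p)).
Proof. by rewrite /a_box; apply: box_continuous; continuity. Qed.

Lemma c_box_continuous : continuous (fun p => c_box (u p) (v p) (sg p) (e p)).
Proof. by rewrite /c_box; apply: box_continuous; continuity. Qed.

End BoxContinuity.

Lemma hub_connected u v : 0 <= u -> 0 <= v ->
  connected (interval_region (hub_box u v)).
Proof.
move=> u0 v0; apply: (@connected_hub _ _ (pt iA1 1)).
move=> q /regionP[x [x01 [[/= zx [->|->]]|[/= zx ->]|[/= zx ->]|[/= zx ->]]]].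
- by apply: region_linked => /=; lra.
- by rewrite -ptA1; apply: region_linked => /=; lra.
- by rewrite -ptB1; apply: region_linked => /=; lra.
- by rewrite -ptB2; apply: region_linked => /=; lra.
- apply: (@connected_component_trans _ _ (pt iA1 0)).
    by apply: region_linked => /=; lra.
  by rewrite -ptE0; apply: region_linked => /=; lra.
Qed.

(** While [v + e <= 1] the vertex a is a hub; afterwards only an interval of the arc a c is left. In
    [c_connected], c and [u] play these roles. *)
Lemma a_connected v sg e : 0 <= v -> 0 <= sg -> 0 <= e ->
  connected (interval_region (a_box v sg e)).
Proof.
move=> v0 sg0 e0; set w := Num.max (sg - e) 0; have w0 : 0 <= w by rewrite le_max lexx orbT.
rewrite /a_box -/w; have [ve|ve] := leP (v + e) 1.
  apply: (@connected_hub _ _ (pt iA1 0)).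
  move=> q /regionP[x [x01 [[/= zx [->|->]]|[/= zx ->]|[/= zx ->]|[/= zx ->]]]]; try lra.
  - by apply: region_linked => /=; lra.
  - by rewrite -ptA0; apply: region_linked => /=; lra.
  - by rewrite -ptE0; apply: region_linked => /=; lra.
apply: (@connected_hub _ _ (pt iE (v - 1 + e))).
move=> q /regionP[x [x01 [[/= zx [->|->]]|[/= zx ->]|[/= zx ->]|[/= zx ->]]]]; try lra.
by apply: region_linked => /=; lra.
Qed.

Lemma c_connected u v sg e : 0 <= u <= 1 -> 0 <= sg -> 0 <= e ->
  connected (interval_region (c_box u v sg e)).
Proof.
move=> u01 sg0 e0; set w := Num.max sg (Num.max e (v - 1 + e)).
have w0 : 0 <= w by rewrite le_max sg0.
rewrite /c_box -/w; have [ue|ue] := leP (u + e) 1.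
  apply: (@connected_hub _ _ (pt iE 1)).
  move=> q /regionP[x [x01 [[/= zx [->|->]]|[/= zx ->]|[/= zx ->]|[/= zx ->]]]]; try lra.
  - by rewrite -ptC1; apply: region_linked => /=; lra.
  - by rewrite -ptC2; apply: region_linked => /=; lra.
  - by apply: region_linked => /=; lra.
apply: (@connected_hub _ _ (pt iE w)).
move=> q /regionP[x [x01 [[/= zx [->|->]]|[/= zx ->]|[/= zx ->]|[/= zx ->]]]]; try lra.
by apply: region_linked => /=; lra.
Qed.

(** The last condition lets share 0 pass beyond a only after it has taken both arcs b c; if it took
    c from the side of a earlier, it would separate the rests of these arcs. *)
Definition ring_params u v sg :=
  [/\ 0 <= u <= 1, 0 <= v <= 2, 0 <= sg <= 1, v - 1 <= sg & v <= 1 \/ u = 1].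

Lemma hub_region u v sg q : ring_params u v sg ->
  interval_region (hub_box u v) q <-> ring_pos q <= u \/ 3 - v <= ring_pos q.
Proof.
move=> [u01 v02 sg01 vsg uv]; split.
  move=> /regionP[x [x01 [[/= zx [->|->]]|[/= zx ->]|[/= zx ->]|[/= zx ->]]]];
    rewrite ring_posE // /ring_coord /=.
  - by have [x1|_] := eqVneq x 1; [left|right]; lra.
  - by have [x1|_] := eqVneq x 1; [left|right]; lra.
  - by left; lra.
  - by left; lra.
  - by right; lra.
(* Share 0 can reach c along the arc a c ([v = 2]) or along the arcs b c ([u = 1]). *)
have ptC0 x : x = 1 -> v = 2 \/ u = 1 -> interval_region (hub_box u v) (pt iE x).
  move=> -> vu; apply/regionP; exists 1; rewrite lexx ler01; split=> //.
  case: vu => [v2|u1]; first by apply: Or44; rewrite /=; split; [lra|].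
  by apply: Or42; rewrite /= ptC1; split; [lra|].
have [i [x [x01 ->]]] := pt_surj q; rewrite ring_posE // /ring_coord.
move: i; apply: I5_ind => /= uvx.
- apply/regionP; exists x; split=> //; apply: Or41; rewrite /=; split; last by left.
  by move: uvx; have [x1|_] := eqVneq x 1 => -[]; lra.
- apply/regionP; exists x; split=> //; apply: Or41; rewrite /=; split; last by right.
  by move: uvx; have [x1|_] := eqVneq x 1 => -[]; lra.
- case: uvx => [xu|vx]; first by apply/regionP; exists x; split=> //; apply: Or42; rewrite /=; split; [lra|].
  have [x1 v2] : x = 1 /\ v = 2 by lra.
  by rewrite x1 ptC1; apply: ptC0 => //; left.
- case: uvx => [xu|vx]; first by apply/regionP; exists x; split=> //; apply: Or43; rewrite /=; split; [lra|].
  have [x1 v2] : x = 1 /\ v = 2 by lra.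
  by rewrite x1 ptC2; apply: ptC0 => //; left.
- case: uvx => [xu|vx]; first by apply: ptC0; [|right]; lra.
  by apply/regionP; exists x; split=> //; apply: Or44; rewrite /=; split; [lra|].
Qed.

Lemma a_region u v sg e q : ring_params u v sg -> 0 < e ->
  interval_region (a_box v sg e) q ->
  u < ring_pos q < 3 - v /\ (2 <= ring_pos q \/ 2 - sg < ring_pos q).
Proof.
move=> [u01 v02 sg01 vsg uv] e0 /regionP[x [x01 [[/= zx [->|->]]|[/= zx ->]|[/= zx ->]|[/= zx ->]]]];
  rewrite ring_posE // /ring_coord /=; try lra.
- by have [x1|_] := eqVneq x 1; split; try left; lra.
- by have [x1|_] := eqVneq x 1; split; try left; lra.
by move: zx; have [|] := ltP (sg - e) 0 => *; split; lra.
Qed.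

Lemma a_region_mem u v sg q : ring_params u v sg -> u < ring_pos q < 3 - v -> 2 <= ring_pos q \/ 2 - sg < ring_pos q ->
  exists2 e, 0 < e < 1 & interval_region (a_box v sg e) q.
Proof.
move=> [u01 v02 sg01 vsg uv].
have [i [x [x01 ->]]] := pt_surj q; rewrite ring_posE // /ring_coord.
move: i; apply: I5_ind => /=.
- have [x1|_] := eqVneq x 1; first by lra.
  move=> uvx _; have [||e [e01 ex _]] := @small_pos R (1 - v - x) 1; try lra.
  by exists e => //; apply/regionP; exists x; split=> //; apply: Or41; rewrite /=; split; [lra|left].
- have [x1|_] := eqVneq x 1; first by lra.
  move=> uvx _; have [||e [e01 ex _]] := @small_pos R (1 - v - x) 1; try lra.
  by exists e => //; apply/regionP; exists x; split=> //; apply: Or41; rewrite /=; split; [lra|right].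
- by move=> uvx [|]; lra.
- by move=> uvx [|]; lra.
(* The vertex a needs only a margin from share 0, thanks to the maximum in [a_box]; other points
   also need one from [sg]. *)
- move=> uvx sx; have [x0|x0] := leP x 0.
    have [||e [e01 ex _]] := @small_pos R (x - v + 1) 1; try lra.
    exists e => //; apply/regionP; exists x; split=> //; apply: Or44; rewrite /= le_max.
    by split=> //; rewrite x0 orbT andbT; lra.
  have [||e [e01 ex esx]] := @small_pos R (x - v + 1) (sg - x); try (by case: sx; lra).
  exists e => //; apply/regionP; exists x; split=> //; apply: Or44; rewrite /= le_max.
  by split=> //; apply/andP; split; [lra|apply/orP; left; lra].
Qed.

Lemma c_region u v sg e q : ring_params u v sg -> 0 < e ->
  interval_region (c_box u v sg e) q ->
  u < ring_pos q < 3 - v /\ ring_pos q < 2 /\ ring_pos q <= 2 - sg.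
Proof.
move=> [u01 v02 sg01 vsg uv] e0 /regionP[x [x01 [[/= zx [->|->]]|[/= zx ->]|[/= zx ->]|[/= zx ->]]]];
  rewrite ring_posE // /ring_coord /=; try lra.
by move: zx; rewrite !ge_max => /andP[/andP[? /andP[? ?]] ?]; split; [lra|split; lra].
Qed.

Lemma c_region_mem u v sg q : ring_params u v sg -> u < ring_pos q < 3 - v -> ring_pos q < 2 -> ring_pos q <= 2 - sg ->
  exists2 e, 0 < e < 1 & interval_region (c_box u v sg e) q.
Proof.
move=> [u01 v02 sg01 vsg uv].
have [i [x [x01 ->]]] := pt_surj q; rewrite ring_posE // /ring_coord.
move: i; apply: I5_ind => /=.
- by have [x1|_] := eqVneq x 1; lra.
- by have [x1|_] := eqVneq x 1; lra.
- move=> ux _ _; have [||e [e01 ex _]] := @small_pos R (x - u) 1; try lra.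
  by exists e => //; apply/regionP; exists x; split=> //; apply: Or42; rewrite /=; split; [lra|].
- move=> ux _ _; have [||e [e01 ex _]] := @small_pos R (x - u) 1; try lra.
  by exists e => //; apply/regionP; exists x; split=> //; apply: Or43; rewrite /=; split; [lra|].
- move=> ux x2 xsg; have [||e1 [e101 e1x e1v]] := @small_pos R x (x - v + 1); try lra.
  have [||e [e01 ee1 eu]] := @small_pos R e1 (2 - x - u); try lra.
  exists e => //; apply/regionP; exists x; split=> //; apply: Or44; rewrite /= !ge_max.
  by split=> //; apply/andP; split; [apply/andP; split; [lra|apply/andP; split; lra]|lra].
Qed.

End RingCase.

(** Exchanging shares 1 and 2 negates the median difference. The swap is needed for reflected
    valuations. *)
Lemma lean_le_swap (R : realType) (V W : 'I_3 -> 'I_3 -> R) :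
  (forall i, V i k1 <= W i k2) -> (forall i, W i k1 <= V i k2) -> lean V <= - lean W.
Proof.
by move=> V1 V2; rewrite /lean -med_opp; apply: med_mono; rewrite opprB; apply: lerB.
Qed.

Section RingParameters.
Variable R : realType.
Implicit Types t s : R.

(** For [1 <= s <= 2] the cut runs along the arc a c (never behind share 0), while share 0 has grown
    by [t] in both directions, up to c in one of them. For [s < 1] share 0 may grow further into
    share 1, and for [s > 2] into share 2, so that at [s = 0] or [s = 3] one of them is degenerate
    at every time [t]. *)
Definition ring_u t s : R := Num.min 1 (Num.max 0 (Num.max t (s - 2))).
Definition ring_v t s : R := Num.max 0 (Num.max t (1 - s)).
Definition ring_sg t s : R := Num.max (Num.max 0 (t - 1)) (Num.min 1 (s - 1)).

Lemma ring_u01 t s : 0 <= ring_u t s <= 1.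
Proof. by rewrite /ring_u; minmax; lra. Qed.

Lemma ring_v0 t s : 0 <= ring_v t s.
Proof. by rewrite /ring_v le_max lexx. Qed.

Lemma ring_sg0 t s : 0 <= ring_sg t s.
Proof. by rewrite /ring_sg !le_max lexx. Qed.

Lemma ring_paramsP t s : 0 <= t <= 2 -> 0 <= s <= 3 ->
  ring_params (ring_u t s) (ring_v t s) (ring_sg t s).
Proof.
move=> t02 s03; split; first exact: ring_u01.
- by rewrite /ring_v; minmax; lra.
- by rewrite /ring_sg; minmax; lra.
- by rewrite /ring_v /ring_sg; minmax; lra.
have [t1|t1] := leP t 1; [left|right].
  by rewrite /ring_v; minmax; lra.
by rewrite /ring_u; minmax; lra.
Qed.

Lemma ring_mono t s s' : s <= s' ->
  [/\ ring_u t s <= ring_u t s', ring_v t s' <= ring_v t s & ring_sg t s <= ring_sg t s'].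
Proof.
move=> ss'; split.
- by apply: min_mono => //; apply: max_mono => //; apply: max_mono => //; lra.
- by apply: max_mono => //; apply: max_mono => //; lra.
- by apply: max_mono => //; apply: min_mono => //; lra.
Qed.

Lemma ring_start s : 1 <= s <= 2 -> ring_u 0 s = 0 /\ ring_v 0 s = 0.
Proof. by move=> s12; rewrite /ring_u /ring_v; split; minmax; lra. Qed.

Lemma ring_sg_start : ring_sg 0 1 = 0 /\ ring_sg 0 2 = 1.
Proof. by rewrite /ring_sg; split; minmax; lra. Qed.

Lemma ring_lo t : 0 <= t <= 2 -> 1 <= ring_v t 0 /\ ring_sg t 0 = ring_v t 0 - 1.
Proof. by move=> t02; rewrite /ring_sg /ring_v; split; minmax; lra. Qed.

Lemma ring_hi t s : 0 <= t <= 2 -> 0 <= s <= 3 -> t = 2 \/ s = 3 ->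
  ring_u t s = 1 /\ ring_sg t s = 1.
Proof. by move=> t02 s03 ts; rewrite /ring_u /ring_sg; split; minmax; lra. Qed.

Lemma ring_end s : 0 <= s -> ring_v 2 s = 2.
Proof. by move=> s0; rewrite /ring_v; minmax; lra. Qed.

End RingParameters.

Section RingDivision.
Variables (R : realType) (nu : 'I_3 -> set (lips R) -> R).
Hypotheses (nu_val : forall i, valuation (nu i))
  (nu_cont : forall i, monotone_continuous (nu i)).

Let ring_shares (u v sg : R) (k : 'I_3) : R -> 'M[R]_(5, 2) :=
  triple (fun=> hub_box u v) (a_box v sg) (c_box u v sg) k.

Let shares_connected u v sg e k : 0 <= u <= 1 -> 0 <= v -> 0 <= sg -> 0 <= e ->
  connected (interval_region (ring_shares u v sg k e)).
Proof.
move=> u01 v0 sg0 e0; move: k; apply: I3_ind.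
- by apply: hub_connected => //; case/andP: u01.
- exact: a_connected.
- exact: c_connected.
Qed.

(** The cut point goes to share 2, except that a, when outside share 0, always goes to share 1:
    without it the remains of the two arcs a b would be disconnected. *)
Let ring_class (u v sg : R) (q : lips R) : 'I_3 :=
  if (ring_pos q <= u) || (3 - v <= ring_pos q) then k0
  else if (ring_pos q < 2) && (ring_pos q <= 2 - sg) then k2 else k1.

Let class_hub u v sg q :
  ring_class u v sg q = k0 <-> ring_pos q <= u \/ 3 - v <= ring_pos q.
Proof.
rewrite /ring_class; case: ifP => [/orP //|/negP H].
by split=> [|/orP //]; case: ifP.
Qed.

Let class_a u v sg q : ring_class u v sg q = k1 <->
  u < ring_pos q < 3 - v /\ (2 <= ring_pos q \/ 2 - sg < ring_pos q).
Proof.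
rewrite /ring_class; split=> [|[/andP[uq qv] /orP qsg]].
  case: ifP => // /negbT; rewrite negb_or -!ltNge => ->; case: ifP => // /negbT.
  by rewrite negb_and -leNgt -ltNge => /orP.
rewrite leNgt uq leNgt qv /= ifF //; apply/negbTE.
by rewrite negb_and -leNgt -ltNge.
Qed.

Let class_c u v sg q : ring_class u v sg q = k2 <->
  [/\ u < ring_pos q < 3 - v, ring_pos q < 2 & ring_pos q <= 2 - sg].
Proof.
rewrite /ring_class; split=> [|[/andP[uq qv] q2 qsg]].
  case: ifP => // /negbT; rewrite negb_or -!ltNge => ->.
  by case: ifP => // /andP[].
by rewrite leNgt uq leNgt qv /= q2 qsg.
Qed.

Let ring_share u v sg k : ring_params u v sg ->
  connected [set q | ring_class u v sg q = k] /\
  forall i, nu i [set q | ring_class u v sg q = k] =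
    nu i (interval_region (ring_shares u v sg k 0)).
Proof.
move=> par; have [u01 /andP[v0 _] /andP[sg0 _] _ _] := par.
have [||||q kq|kconn kval] :=
  @share_limit R [set q | ring_class u v sg q = k] (ring_shares u v sg k).
- move: k; apply: I3_ind; first exact: cont_const.
  + by apply: (a_box_continuous (v := fun=> v) (sg := fun=> sg) (e := idfun));
      (exact: cont_const || exact: cont_id).
  + by apply: (c_box_continuous (u := fun=> u) (v := fun=> v) (sg := fun=> sg) (e := idfun));
      (exact: cont_const || exact: cont_id).
- by move=> e /andP[e0 _]; exact: shares_connected.
- move=> e e' e0 ee'; move: k; apply: I3_ind; first by [].
  + by apply: region_sub; split=> /=; minmax; lra.
  + by apply: region_sub; split=> /=; minmax; lra.
- move=> e /andP[e0 _] q; move: k; apply: I3_ind => /=.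
  + by move=> /(hub_region q par) H; apply/class_hub.
  + by move=> /(a_region par e0) H; apply/class_a.
  + by move=> /(c_region par e0)[? [? ?]]; apply/class_c.
- move: k kq; apply: I3_ind => /=.
  + move=> /class_hub /(hub_region q par) H; exists 2^-1 => //; lra.
  + by move=> /class_a[? ?]; exact: (a_region_mem par).
  + by move=> /class_c[? ? ?]; exact: (c_region_mem par).
by split=> // i; rewrite kval.
Qed.

Let V (p : R * R) (i k : 'I_3) : R := nu i (interval_region
  (ring_shares (ring_u p.1 p.2) (ring_v p.1 p.2) (ring_sg p.1 p.2) k 0)).

Let V_connected t s k : connected (interval_region
  (ring_shares (ring_u t s) (ring_v t s) (ring_sg t s) k 0)).
Proof. by apply: shares_connected; rewrite ?ring_u01 ?ring_v0 ?ring_sg0. Qed.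

Let Vcont i k : continuous (fun p => V p i k).
Proof.
have uc : continuous (fun p : R * R => ring_u p.1 p.2) by rewrite /ring_u; continuity.
have vc : continuous (fun p : R * R => ring_v p.1 p.2) by rewrite /ring_v; continuity.
have sgc : continuous (fun p : R * R => ring_sg p.1 p.2) by rewrite /ring_sg; continuity.
apply: nu_region_continuous => //.
move: k; apply: I3_ind; first exact: hub_box_continuous.
  by apply: (a_box_continuous (e := fun=> 0)) => //; exact: cont_const.
by apply: (c_box_continuous (e := fun=> 0)) => //; exact: cont_const.
Qed.

Let V_ge0 t s i k : 0 <= V (t, s) i k.
Proof. by apply: nu_val; exact: V_connected. Qed.

Let V_mono t s s' i : 0 <= t <= 2 -> 0 <= s -> s <= s' -> s' <= 3 ->
  V (t, s) i k1 <= V (t, s') i k1 /\ V (t, s') i k2 <= V (t, s) i k2.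
Proof.
move=> t02 s0 ss' s'3; have [_ mono _] := nu_cont i.
have [uu vv sgsg] := ring_mono t ss'.
have [|_ _ sg01 vsg _] := @ring_paramsP _ t s t02; first by lra.
have [|_ _ sg01' vsg' _] := @ring_paramsP _ t s' t02; first by lra.
have sg0 := ring_sg0 t s.
split; (apply: mono; [exact: V_connected..|]); apply: region_sub; split=> /=; try lra.
  by apply: max_mono => //; lra.
move: (ring_sg t s) (ring_sg t s') sgsg sg0 vsg => x y xy x0 vx.
rewrite le_max; apply/orP; left; rewrite !ge_max.
by apply/andP; split=> //; apply/andP; split; lra.
Qed.

Let V_degenerate t s i k :
  (forall j, ring_shares (ring_u t s) (ring_v t s) (ring_sg t s) k 0 j 1 <=
    ring_shares (ring_u t s) (ring_v t s) (ring_sg t s) k 0 j 0) -> V (t, s) i k = 0.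
Proof. by move=> deg; apply: nu_degenerate => //; exact: V_connected. Qed.

Let V2_hi t s i : 0 <= t <= 2 -> 0 <= s <= 3 -> t = 2 \/ s = 3 -> V (t, s) i k2 = 0.
Proof.
move=> t02 s03 ts; have [u1 sg1] := ring_hi t02 s03 ts.
by apply: V_degenerate; apply: I5_ind; rewrite !mxE /= ?u1 ?sg1; minmax; lra.
Qed.

Let V1_lo t i : 0 <= t <= 2 -> V (t, 0) i k1 = 0.
Proof.
move=> t02; have [v1 sgE] := ring_lo t02.
by apply: V_degenerate; apply: I5_ind; rewrite !mxE /= ?sgE; minmax; lra.
Qed.

Let V1_end s i : 0 <= s <= 3 -> V (2, s) i k1 = 0.
Proof.
move=> s03; have [| |_ sg1] := @ring_hi R 2 s _ s03; [lra|by left|].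
have v2 : ring_v 2 s = 2 by apply: ring_end; case/andP: s03.
by apply: V_degenerate; apply: I5_ind; rewrite !mxE /= ?sg1 ?v2; minmax; lra.
Qed.

Let V0_start s i : 1 <= s <= 2 -> V (0, s) i k0 = 0.
Proof.
move=> s12; have [u0 v0] := ring_start s12.
by apply: V_degenerate; apply: I5_ind; rewrite !mxE /= ?u0 ?v0; lra.
Qed.

Let S (al be : R) := interval_region (string_box al be).

(** At [s = 2] the cut is at c: share 1 contains K and share 2 lies in the two arcs b c. *)
Let V_hi : 0 <= lean (fun i => nu i \o triple set0 (S 0 2) (S 2 4)) ->
  0 <= lean (V (0, 2)).
Proof.
move=> KC; apply: le_trans KC _; apply: lean_le => i;
  (have [_ mono _] := nu_cont i); apply: mono; try exact: V_connected.
- by apply: string_connected; lra.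
- move=> q; have [|u0 v0] := @ring_start R 2; first by lra.
  have [_ sg1] := ring_sg_start R; rewrite /ring_shares /triple /= /a_box ?u0 ?v0 ?sg1.
  move=> /regionP[x [x01 [[/= zx qE]|[/= zx ->]|[/= zx ->]|[/= zx ->]]]]; apply/regionP.
  + by exists x; split=> //; apply: Or41; split=> //=; lra.
  + have -> : x = 0 by lra.
    exists 1; split; first by lra.
    by apply: Or41; split; [rewrite /=; lra|rewrite ptB1; left].
  + by lra.
  + by exists x; split=> //; apply: Or44; split=> //=; minmax; lra.
- by apply: string_connected; lra.
- move=> q; have [|u0 v0] := @ring_start R 2; first by lra.
  have [_ sg1] := ring_sg_start R; rewrite /ring_shares /triple /= /c_box ?u0 ?v0 ?sg1.
  move=> /regionP[x [x01 [[/= zx _]|[/= zx ->]|[/= zx ->]|[/= zx ->]]]]; first by lra.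
  + by apply/regionP; exists x; split=> //; apply: Or42; split=> //=; lra.
  + by apply/regionP; exists x; split=> //; apply: Or43; split=> //=; lra.
  + have -> : x = 1 by move: zx; rewrite ge_max; lra.
    apply/regionP; exists 1; split; first by lra.
    by apply: Or42; split; [rewrite /=; lra|rewrite ptC1].
Qed.

(** At [s = 1] the cut is at a: share 1 lies in the two arcs a b, the mirror image of the arcs b c,
    and share 2 contains the mirror image of K. *)
Let V_lo : 0 <= lean (fun i => reflect_nu (nu i) \o triple set0 (S 0 2) (S 2 4)) ->
  lean (V (0, 1)) <= 0.
Proof.
move=> KC; rewrite -oppr_ge0; apply: le_trans KC _; rewrite lerNr.
apply: lean_le_swap => i;
  (have [_ mono _] := nu_cont i); apply: mono; try exact: V_connected.
- by apply: reflect_connected; apply: string_connected; lra.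
- move=> q; have [|u0 v0] := @ring_start R 1; first by lra.
  have [sg0 _] := ring_sg_start R; rewrite /ring_shares /triple /= /a_box ?u0 ?v0 ?sg0.
  move=> zq; exists (reflect_lips q); last exact: reflect_lipsK.
  move: zq => /regionP[x [x01 [[/= zx [->|->]]|[/= zx _]|[/= zx _]|[/= zx ->]]]];
    try lra; rewrite reflect_pt //; apply/regionP.
  + by exists (1 - x); split; [lra|apply: Or42; split=> //=; lra].
  + by exists (1 - x); split; [lra|apply: Or43; split=> //=; lra].
  + have x0 : x = 0 by move: zx; minmax; lra.
    exists 1; split; first by lra.
    by apply: Or42; split; [rewrite /=; lra|rewrite x0 subr0 ptC1].
- by apply: reflect_connected; apply: string_connected; lra.
- move=> _ [q + <-]; have [|u0 v0] := @ring_start R 1; first by lra.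
  have [sg0 _] := ring_sg_start R; rewrite /ring_shares /triple /= /c_box ?u0 ?v0 ?sg0.
  move=> /regionP[x [x01 [[/= zx [->|->]]|[/= zx ->]|[/= zx _]|[/= zx ->]]]];
    try lra; rewrite reflect_pt //; apply/regionP.
  + by exists (1 - x); split; [lra|apply: Or42; split=> //=; lra].
  + by exists (1 - x); split; [lra|apply: Or43; split=> //=; lra].
  + have x0 : x = 0 by lra.
    exists 0; split; first by lra.
    by apply: Or42; split; [rewrite /=; lra|rewrite x0 subr0 ptB1].
  + by exists (1 - x); split; [lra|apply: Or44; split=> //=; minmax; lra].
Qed.

Lemma ring_division :
  0 <= lean (fun i => nu i \o triple set0 (S 0 2) (S 2 4)) ->
  0 <= lean (fun i => reflect_nu (nu i) \o triple set0 (S 0 2) (S 2 4)) ->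
  exists T : 'I_3 -> set (lips R), connected_allocation T /\ envy_free nu T.
Proof.
move=> /V_hi hi /V_lo lo.
have [||||||t [s [f [t02 s03 finj fV]]]] := @knife_assignment R V 2 0 3 Vcont.
- by lra.
- by lra.
- by move=> t s s' i; exact: V_mono.
- move=> t t02; apply/andP; split.
    by apply: lean_le0 => i; rewrite V1_lo.
  by apply: lean_ge0 => i; rewrite V2_hi //; [lra|right].
(* The initial cut is sought on the arc a c, where [u = v = 0] and share 0 is degenerate; [lo] and
   [hi] give the change of sign there. *)
- have [|s s12 Ds] := @lean_zero R V Vcont 0 1 2 _ lo hi; first by lra.
  exists s; split=> // [|i]; first by lra.
  by apply: gain_le0; [exact: V0_start|exact: V_ge0].
- move=> s s03; apply: gain_ge0; [exact: V_ge0|exact: V1_end|].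
  by apply: V2_hi => //; [lra|left].
have share k := ring_share k (ring_paramsP t02 s03).
apply: (@envy_free_exists _ _ (ring_class (ring_u t s) (ring_v t s) (ring_sg t s)) f finj).
  by move=> k; have [] := share k.
by move=> i k; have [_ ->] := share k; have [_ ->] := share (f i); exact: fV.
Qed.

End RingDivision.

(** * Choice between the trail, its mirror image and the growth from b *)

Theorem theorem4p1 (R : realType) (nu : 'I_3 -> set (lips R) -> R)
    (nu_val : forall i : 'I_3, valuation (nu i))
    (nu_cont : forall i : 'I_3, monotone_continuous (nu i)) :
  exists T : 'I_3 -> set (lips R), connected_allocation T /\ envy_free nu T.
Proof.
set KC := triple set0 (interval_region (string_box (0 : R) 2))
  (interval_region (string_box 2 4)).
(* A nonpositive value means that the two arcs b c are worth at least as much as K in the median;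
   after reflection the arcs a b take their place. *)
have [le0|/ltW ge0] := leP (lean (fun i => nu i \o KC)) 0.
  exact: string_division.
have [le0'|/ltW ge0'] := leP (lean (fun i => reflect_nu (nu i) \o KC)) 0.
  apply: reflect_allocation; apply: string_division => // i.
    exact: reflect_valuation.
  exact: reflect_monotone_continuous.
exact: ring_division.
Qed.
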